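(* Let $H$, $A$, $m$ be as in the context. Let $(u_{0\varepsilon},u_{1\varepsilon})\to(u_0,u_1)$ in $D(A^{3/4})\times D(A^{1/4})$ (as $\varepsilon\to0^+$) be a converging family of initial data, let $u_\varepsilon(t)$ and $u(t)$ denote the corresponding solutions of $$u''(t)+m\left(|A^{1/2}u(t)|^2\right)Au(t)=0$$ with initial data $(u_{0\varepsilon},u_{1\varepsilon})$ and $(u_0,u_1)$ respectively, and let $\mathcal{LS}(u_{0\varepsilon},u_{1\varepsilon})$ and $\mathcal{LS}(u_0,u_1)$ denote the life spans of these solutions (possibly equal to $+\infty$). Then the following statements hold true. (1) (Lower semicontinuity of the life span) It turns out that $$\liminf_{\varepsilon\to0^+}\mathcal{LS}(u_{0\varepsilon},u_{1\varepsilon})\ge\mathcal{LS}(u_0,u_1).$$ (2) (Continuous dependence on the initial condition) For every $T<\mathcal{LS}(u_0,u_1)$ it turns out that $u_\varepsilon(t)\to u(t)$ in the sense that $$E_{(u_\varepsilon-u)}(t)\to0\qquad\text{uniformly in }[0,T].$$ (3) (''Lipschitz like'' convergence rate when $(u_0,u_1)$ is more regular) Assume in addition that $(u_0,u_1)\in D(A^{5/4})\times D(A^{3/4})$. Then for every $T<\mathcal{LS}(u_0,u_1)$ there exists a constant $\Gamma$ such that $$E_{(u_\varepsilon-u)}(t)\le\Gamma\cdot E_{(u_\varepsilon-u)}(0)\qquad\forall t\in[0,T].$$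
   Context: Standing assumptions. $H$ is a real Hilbert space with norm $|\cdot|$ and inner product $\langle\cdot,\cdot\rangle$. $A$ is a self-adjoint operator on $H$ with domain $D(A)$ for which there are an orthonormal basis $\{e_k\}_{k\ge1}$ of $H$ and a sequence $\{\lambda_k\}$ of nonnegative reals with $Ae_k=\lambda_k^2e_k$ for all $k\ge1$. For $\alpha\ge0$, $D(A^\alpha)=\{z\in H:\sum_k\lambda_k^{4\alpha}\langle z,e_k\rangle^2<\infty\}$ with the graph norm, and $A^\alpha z=\sum_k\lambda_k^{2\alpha}\langle z,e_k\rangle e_k$. The function $m:[0,+\infty)\to\mathbb{R}$ is of class $C^1$ and there is a constant $\nu_0>0$ with $m(\sigma)\ge\nu_0$ for all $\sigma\ge0$. Solutions and life span. Solutions on an interval $[0,T]$ are understood in the class $C^0([0,T],D(A^{3/4}))\cap C^1([0,T],D(A^{1/4}))$. Known local theory: for every $(u_0,u_1)\in D(A^{3/4})\times D(A^{1/4})$ there is, for some $T>0$, a unique solution in this class of $u''+m(|A^{1/2}u|^2)Au=0$ with $u(0)=u_0$, $u'(0)=u_1$, and it can be continued to a solution on a maximal interval $[0,T_{\max})$ where either $T_{\max}=+\infty$ or $\limsup_{t\to T_{\max}^-}(|A^{1/4}u'(t)|^2+|A^{3/4}u(t)|^2)=+\infty$. The life span is $\mathcal{LS}(u_0,u_1):=T_{\max}$, which is either a positive real number or $+\infty$. Energy. For a function $z$ in $C^0([0,T],D(A^{3/4}))\cap C^1([0,T],D(A^{1/4}))$, $E_z(t):=|z'(t)|^2+|A^{1/4}z'(t)|^2+|A^{1/2}z(t)|^2+|A^{3/4}z(t)|^2$.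 *)

(* Defs.v *)
From HB Require Import structures.
From mathcomp Require Export all_boot all_order all_algebra.
From mathcomp Require Export all_classical all_reals all_analysis.
From mathcomp Require Export sesquilinear.

Set Implicit Arguments.
Unset Strict Implicit.
Unset Printing Implicit Defensive.

Import Order.TTheory GRing.Theory Num.Theory.
Import numFieldNormedType.Exports.

Local Open Scope classical_set_scope.
Local Open Scope ring_scope.

Section derivative_on.
Context {R : realType} {V : normedModType R}.
Implicit Types (I : set R) (f : R -> V).

Definition diff_quot f (t s : R) : V := (s - t)^-1 *: (f s - f t).

(* Derivative relative to I: one-sided at those endpoints that belong to I. *)
Definition deriv_on I f (t : R) : V :=
  lim (diff_quot f t s @[s --> within I t^']).

Definition C1_on I f : Prop :=
  (forall t, I t -> diff_quot f t s @[s --> within I t^'] --> deriv_on I f t) /\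
  {within I, continuous (deriv_on I f)}.

End derivative_on.

Section operators.
Context {R : realType} {H : completeNormedModType R}.
Variable ip : {dot H for idfun}.

(* Together with completeness of H: H is a real Hilbert space. *)
Definition norm_from_dot : Prop := forall x : H, `|x| ^+ 2 = ip x x.

Definition orthonormal_basis (e : nat -> H) : Prop :=
  (forall j k, ip (e j) (e k) = (j == k)%:R) /\
  (forall x : H, series (fun k => ip x (e k) *: e k) @ \oo --> x).

(* A is an unbounded operator with domain DA; its values off DA are
   irrelevant. The last clause says that the adjoint of A, as a partial
   operator, is A itself. *)
Definition self_adjoint (DA : set H) (A : H -> H) : Prop :=
  [/\ dense DA,
      (forall (a : R) x y, DA x -> DA y ->
         DA (a *: x + y) /\ A (a *: x + y) = a *: A x + A y)
    & (forall y z, (forall x, DA x -> ip (A x) y = ip x z) <->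
                   (DA y /\ A y = z))].

End operators.

Section powers.
Context {R : realType} {H : completeNormedModType R}.
Variables (ip : {dot H for idfun}) (e : nat -> H) (lam : nat -> R).
Implicit Types (a : R) (I : set R).

Definition domP a : set H :=
  [set z | (\sum_(0 <= k <oo) ((lam k `^ (4 * a) * ip z (e k) ^+ 2)%:E)
            < +oo)%E].

(* Meaningful on [domP a] only. *)
Definition powA a (z : H) : H :=
  lim (series (fun k => (lam k `^ (2 * a) * ip z (e k)) *: e k) @ \oo).

Definition graph_norm a (z : H) : R :=
  Num.sqrt (`|z| ^+ 2 + `|powA a z| ^+ 2).

(* f --> l along F in the space D(A^a) with its graph norm *)
Definition cvg_domP a (F : set_system R) (f : R -> H) (l : H) : Prop :=
  [/\ domP a l, \forall s \near F, domP a (f s)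
    & graph_norm a (f s - l) @[s --> F] --> (0 : R)].

Definition C0_domP I a (z : R -> H) : Prop :=
  forall t, I t -> cvg_domP a (within I (nbhs t)) z (z t).

Definition C1_domP I a (z : R -> H) : Prop :=
  [/\ C0_domP I a z,
      (forall t, I t ->
         cvg_domP a (within I t^') (diff_quot z t) (deriv_on I z t))
    & C0_domP I a (deriv_on I z)].

Definition energy I (z : R -> H) (t : R) : R :=
  `|deriv_on I z t| ^+ 2 + `|powA (1 / 4) (deriv_on I z t)| ^+ 2
  + `|powA (1 / 2) (z t)| ^+ 2 + `|powA (3 / 4) (z t)| ^+ 2.

(* u'' + m(|A^{1/2}u|^2) A u = 0 on I. For u in D(A^{3/4}) the term A u is only
   an element of D(A^{-1/4}), the dual of D(A^{1/4}), namely the functional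
   phi |-> <A^{3/4}u, A^{1/4}phi>; the equation is an identity in that dual. *)
Definition kirchhoff_eq (m : R -> R) I (u : R -> H) : Prop :=
  forall t, I t -> forall phi, domP (1 / 4) phi ->
    diff_quot (fun s => ip (deriv_on I u s) phi : R) t s @[s --> within I t^']
      --> - (m (`|powA (1 / 2) (u t)| ^+ 2)
             * ip (powA (3 / 4) (u t)) (powA (1 / 4) phi)).

Definition solution (m : R -> R) I (u0 u1 : H) (u : R -> H) : Prop :=
  [/\ C0_domP I (3 / 4) u, C1_domP I (1 / 4) u, kirchhoff_eq m I u,
      u 0 = u0 & deriv_on I u 0 = u1].

Definition life_span (m : R -> R) (u0 u1 : H) : \bar R :=
  ereal_sup [set T%:E | T in
    [set T | 0 < T /\ exists u, solution m `[0, T] u0 u1 u]].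

(* The maximal solution provided by the local existence theory, with its
   blow-up alternative at the end of the life span. *)
Definition maximal_solution (m : R -> R) (u0 u1 : H) (u : R -> H) : Prop :=
  let L := life_span m u0 u1 in
  let J := [set t : R | 0 <= t /\ (t%:E < L)%E] in
  [/\ (0 < L)%E, solution m J u0 u1 u
    & L = +oo%E \/
      exists2 T, L = T%:E &
        limf_esup (fun t => (`|powA (1 / 4) (deriv_on J u t)| ^+ 2
                             + `|powA (3 / 4) (u t)| ^+ 2)%:E) T^'- = +oo%E].

End powers.

(* Main.v *)
Require Import Defs.
From mathcomp Require Import ring lra.

Set Implicit Arguments.
Unset Strict Implicit.
Unset Printing Implicit Defensive.

Import Order.TTheory GRing.Theory Num.Theory.
Import numFieldNormedType.Exports.

Local Open Scope classical_set_scope.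
Local Open Scope ring_scope.

(** Expand everything in the eigenbasis. The k-th mode of a solution u solves
    x'' = - c(t) lam_k^2 x, where the coefficient c(t) = m(|A^(1/2) u(t)|^2) is the
    same for all modes. Although u is only C1 with values in D(A^(1/4)), c is
    differentiable, because |A^(1/2) u|^2 has derivative
    2 <A^(1/4) u', A^(3/4) u>; so c' is bounded by the energy. The energy is the
    sum of (1 + lam_k) (x_k'^2 + lam_k^2 x_k^2). Three estimates follow, with
    constants depending only on a bound M for the energies involved.

    (a) Every mode grows by at most a factor that is independent of k
    ([mode_growth]): tails of the energy at time t are controlled by tails at
    time 0.

    (b) The difference of two solutions v and u solves the equation with
    coefficient c_v and forcing (c_v - c_u) A u ([weighted_difference_growth]). In
    the norm that is weaker by one power of lam_k, the forcing is controlled by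
    |A^(3/4) u|, and c_v - c_u is Lipschitz in that same weak norm; Gronwall's
    inequality gives Lipschitz dependence in the weak norm for all data.

    (c) In the energy norm itself the forcing requires |A^(5/4) u|. For data in
    D(A^(5/4)) x D(A^(3/4)) this is bounded by (a), and the Lipschitz estimate (3)
    results ([regular_modes_lipschitz]).

    For general data, convergence in the energy norm comes from splitting the
    frequencies ([modes_stable]): on finitely many modes the weak and the strong
    norm are equivalent and (b) applies, while by (a) the remaining tails are
    uniformly small, since the initial data converge. No approximation of the data
    by smoother ones, hence no existence theorem, is involved.

    The bound M on the energy of the perturbed solution is obtained by continuity
    in time ([gap_small]): as long as the energy of the difference is at most 1, M
    is fixed, and the estimate shows that this energy is in fact at most 1 / 2.
    The same bound excludes, by the blow-up alternative, that the perturbed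
    solution ends before T ([maximal_gap_small]), which is the lower
    semicontinuity (1), and it allows comparing the solutions on all of [0, T],
    which gives (2) and (3). *)

(** * A Gronwall inequality for suprema of families *)

Section gronwall.
Context {R : realType}.
Implicit Types (S C b t s : R) (F dF : nat -> R -> R).

Lemma is_derive_continuous (f : R -> R) (x d : R) :
  is_derive x 1 f d -> {for x, continuous f}.
Proof.
by move=> [fx _]; exact/differentiable_continuous/derivable1_diffP.
Qed.

Lemma deriv_le0_le (f df : R -> R) (a b : R) : a <= b ->
  (forall x, a < x < b -> is_derive x 1 f (df x)) ->
  {within `[a, b], continuous f} ->
  (forall x, a < x < b -> df x <= 0) -> f b <= f a.
Proof.
rewrite le_eqVlt => /predU1P[->//|ab] fdf cf df0.
have fdf' x : x \in `]a, b[ -> is_derive x 1 f (df x).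
  by rewrite in_itv/=; exact: fdf.
have [x] := MVT ab fdf' cf.
rewrite in_itv/= => xab fE; rewrite -subr_le0 fE.
by rewrite mulr_le0_ge0 ?df0// subr_ge0 ltW.
Qed.

Lemma within_itv_le (V : topologicalType) (f : R -> V) (a s S : R) : s <= S ->
  {within `[a, S], continuous f} -> {within `[a, s], continuous f}.
Proof.
move=> sS; apply: continuous_subspaceW => x /=; apply: subitvP.
by rewrite subitvE/= !bnd_simp.
Qed.

Lemma in_itvcc (a b x : R) : (x \in `[a, b]) = (a <= x <= b).
Proof. by rewrite in_itv. Qed.

(** The derivative of each member is bounded by the supremum of the whole
    family, and that supremum need not be continuous in time, so it is never
    integrated. Let G be the supremum of exp(-2Ct) F k t over all k and t. Each
    member grows by at most the integral of C G exp(2Ct), which is at most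
    (G / 2) exp(2Ct); hence G <= b + G / 2. This is where the boundedness by B is
    used: G has to be finite before it can be absorbed. *)
Lemma gronwall_sup S C F dF (B : R) :
  0 < C ->
  (forall n t, 0 < t < S -> is_derive t 1 (F n) (dF n t)) ->
  (forall n, {within `[0, S], continuous (F n)}) ->
  (forall n t, 0 <= t <= S -> 0 <= F n t <= B) ->
  (forall n t b, 0 < t < S -> (forall k, F k t <= b) -> dF n t <= C * b) ->
  forall b, (forall n, F n 0 <= b) ->
  forall n t, 0 <= t <= S -> F n t <= 2 * expR (2 * C * t) * b.
Proof.
move=> C0 dFF cF FB dFle b F0b n t tS.
have S0 : 0 <= S by move: tS => /andP[/le_trans]; apply.
have zS' : (0 : R) <= 0 <= S by rewrite lexx.
have b0 : 0 <= b by apply: le_trans (F0b 0%N); case/andP: (FB 0%N _ zS').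
pose E s := expR (2 * C * s).
have E0 s : 0 < E s by exact: expR_gt0.
have E1 s : 0 <= s -> 1 <= E s.
  by move=> s0; rewrite -expR0 ler_expR !mulr_ge0// ltW.
pose X := [set x | exists k s, 0 <= s <= S /\ x = F k s / E s].
have X0 : X !=set0 by exists (F 0%N 0 / E 0), 0%N, 0.
have ubX : ubound X B.
  move=> _ [k [s [sS ->]]]; have /andP[F0 FleB] := FB k s sS.
  apply: le_trans FleB; rewrite ler_pdivrMr// ler_peMr// E1//.
  by case/andP: sS.
have supX : has_sup X by split=> //; exists B.
pose G := sup X.
have FG k s : 0 <= s <= S -> F k s <= G * E s.
  move=> sS; rewrite -ler_pdivrMr//.
  by apply: (ub_le_sup supX.2); exists k, s.
have G0 : 0 <= G.
  apply: le_trans (_ : F 0%N 0 / E 0 <= _).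
    by rewrite divr_ge0 ?(ltW (E0 _))//; case/andP: (FB 0%N _ zS').
  by apply: (ub_le_sup supX.2); exists 0%N, 0.
(* G / 2 * E is a primitive of the bound C * (G * E) on the derivative. *)
have step k s : 0 <= s <= S -> F k s <= b + G / 2 * E s.
  move=> /andP[s0 sleS].
  pose f x := F k x - (G / 2 * E x).
  pose df x := dF k x - (G * C * E x).
  have dexp (x : R) : is_derive x 1 (fun x => G / 2 * E x) (G * C * E x).
    by rewrite /E; apply: is_derive_eq; rewrite /GRing.scale/=; field.
  have contS : {within `[0, S], continuous f}.
    move=> x; apply: cvgB; first exact: cF.
    have cE : continuous (fun x => G / 2 * E x).
      by move=> y; exact: is_derive_continuous.
    exact: (continuous_subspaceT cE).
  have contf : {within `[0, s], continuous f} by exact: within_itv_le contS.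
  suff : f s <= f 0.
    rewrite /f {2}/E mulr0 expR0 mulr1 => fs.
    have := F0b k; have := G0; lra.
  apply: (@deriv_le0_le f df 0 s) => // x /andP[x0 xs].
    by apply: is_deriveB => //; apply: dFF; rewrite x0 (lt_le_trans xs).
  rewrite subr_le0 mulrAC mulrC; apply: dFle => [|j].
    by rewrite x0 (lt_le_trans xs).
  by apply: FG; rewrite (ltW x0) ltW// (lt_le_trans xs).
have GleB : G <= b + G / 2.
  apply: ge_sup => // _ [k [s [sS ->]]].
  rewrite ler_pdivrMr// (le_trans (step k s sS))// mulrDl lerD2r.
  by rewrite ler_peMr// E1//; case/andP: sS.
apply: le_trans (FG n t tS) _.
by rewrite mulrAC ler_pM2r//; lra.
Qed.
End gronwall.

(** * Energies of finitely many modes *)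

Section modes.
Context {R : realType}.
Implicit Types (lam om : nat -> R) (x y : nat -> R) (n : nat).

(** The modes have positions x and velocities y. The weight 1 + lam gives the
    energy of the difference of two solutions, 1 / (1 + lam) a norm weaker by one
    full power of lam, and a weight concentrated at one index a single mode. *)
Definition mode_energy lam om n x y : R :=
  \sum_(k < n) om k * (y k ^+ 2 + lam k ^+ 2 * x k ^+ 2).

Lemma is_derive_sum_fun n (h : nat -> R -> R) (dh : nat -> R) (t : R) :
  (forall k, is_derive t 1 (h k) (dh k)) ->
  is_derive t 1 (fun s => \sum_(k < n) h k s) (\sum_(k < n) dh k).
Proof.
move=> hd; elim: n => [|n IHn].
  under eq_fun do rewrite big_ord0.
  by rewrite big_ord0; exact: is_derive_cst.
under eq_fun do rewrite big_ord_recr/=.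
by rewrite big_ord_recr/=; exact: is_deriveD.
Qed.

Lemma within_sum_continuous (A : set R) n (h : nat -> R -> R) :
  (forall k, {within A, continuous (h k)}) ->
  {within A, continuous (fun s => \sum_(k < n) h k s)}.
Proof.
move=> hc; elim: n => [|n IHn].
  under eq_fun do rewrite big_ord0.
  by move=> x; exact: cvg_cst.
under eq_fun do rewrite big_ord_recr/=.
by move=> x; apply: cvgD; [exact: IHn|exact: hc].
Qed.

(** The forced linear oscillators x'' = - c lam^2 x - d lam^2 p. For the
    difference of two solutions, c is the coefficient of one of them, d the
    difference of the two coefficients, and p the modes of the other. The quantity
    that obeys a differential inequality is the sum of the
    om (y^2 + c lam^2 x^2): its derivative contains c' lam^2 x^2, which is at most
    K / nu times the quantity itself, and the forcing term, which Young's
    inequality splits into y^2 and d^2 lam^4 p^2. Since d depends on all modes at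
    once, the resulting inequality for a finite number of modes does not close,
    and the Gronwall inequality for suprema is needed. *)
Lemma forced_mode_energy_le (S T K nu m1 D P B : R) lam om
    (x y p : nat -> R -> R) (c dc d : R -> R) :
  S <= T -> 0 < nu -> 0 <= K -> 0 <= D -> 0 <= P -> (forall k, 0 <= om k) ->
  (forall k t, 0 < t < S -> is_derive t 1 (x k) (y k t)) ->
  (forall k t, 0 < t < S -> is_derive t 1 (y k)
     (- (c t * (lam k ^+ 2 * x k t)) - d t * (lam k ^+ 2 * p k t))) ->
  (forall t, 0 < t < S -> is_derive t 1 c (dc t)) ->
  (forall k, {within `[0, S], continuous (x k)}) ->
  (forall k, {within `[0, S], continuous (y k)}) ->
  {within `[0, S], continuous c} ->
  (forall t, 0 <= t <= S -> nu <= c t <= m1) ->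
  (forall t, 0 < t < S -> `|dc t| <= K) ->
  (forall n t, 0 <= t <= S -> mode_energy lam om n (x^~ t) (y^~ t) <= B) ->
  (forall t b, 0 < t < S ->
     (forall n, \sum_(k < n) om k * (lam k ^+ 2 * x k t ^+ 2) <= b) ->
     d t ^+ 2 <= D * b) ->
  (forall n t, 0 < t < S ->
     \sum_(k < n) om k * (lam k ^+ 4 * p k t ^+ 2) <= P) ->
  forall b, (forall n, mode_energy lam om n (x^~ 0) (y^~ 0) <= b) ->
  forall n t, 0 <= t <= S -> mode_energy lam om n (x^~ t) (y^~ t) <=
    2 * expR (2 * (K / nu + 1 + D * P / nu) * T) * (1 + m1) * (1 + nu^-1) * b.
Proof.
move=> ST nu0 K0 D0 P0 om0 dx dy ddc cx cy cc cb dcK EB dD pP b Eb n t tS.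
have S0 : 0 <= S by move: tS => /andP[/le_trans]; apply.
set C := _ + _ + _.
have C0 : 0 < C.
  have h1 := divr_ge0 K0 (ltW nu0).
  have h2 := divr_ge0 (mulr_ge0 D0 P0) (ltW nu0).
  by rewrite /C; lra.
pose F n t := \sum_(k < n) om k * (y k t ^+ 2 + c t * (lam k ^+ 2 * x k t ^+ 2)).
pose dF n t := \sum_(k < n) om k * (dc t * (lam k ^+ 2 * x k t ^+ 2)
   - 2 * d t * (lam k ^+ 2 * p k t) * y k t).
have m10 : 0 <= m1.
  have /andP[h1 h2] := cb 0 (introT andP (conj (lexx 0) S0)).
  by apply: le_trans h2; apply: le_trans h1; exact: ltW.
have lx0 k s : 0 <= lam k ^+ 2 * x k s ^+ 2 by rewrite mulr_ge0 ?sqr_ge0.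
(* F and the energy are comparable because nu <= c <= m1. *)
have FE j s : 0 <= s <= S -> F j s <= (1 + m1) * mode_energy lam om j (x^~ s) (y^~ s).
  move=> sS; rewrite mulr_sumr; apply: ler_sum => k _.
  rewrite [leRHS]mulrCA; apply: ler_wpM2l => //.
  have /andP[_ cm] := cb s sS.
  rewrite mulrDr lerD//; first by rewrite ler_peMl ?sqr_ge0// lerDl.
  by apply: ler_wpM2r => //; lra.
have EF j s : 0 <= s <= S -> mode_energy lam om j (x^~ s) (y^~ s) <= (1 + nu^-1) * F j s.
  move=> sS; rewrite mulr_sumr; apply: ler_sum => k _.
  rewrite [leRHS]mulrCA; apply: ler_wpM2l => //.
  have /andP[cm _] := cb s sS.
  have i0 : 0 < nu^-1 by rewrite invr_gt0.
  rewrite mulrDr lerD//; first by rewrite ler_peMl ?sqr_ge0// lerDl ltW.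
  rewrite [leRHS]mulrA ler_peMl//.
  have : 1 <= nu^-1 * c s by rewrite ler_pdivlMl// mulr1.
  by rewrite mulrDl mul1r; move: cm nu0; lra.
have F0 j s : 0 <= s <= S -> 0 <= F j s.
  move=> sS; apply: sumr_ge0 => k _; rewrite mulr_ge0// addr_ge0 ?sqr_ge0//.
  rewrite mulr_ge0//; have /andP[cm _] := cb s sS.
  by apply: le_trans cm; exact: ltW.
have derF j s : 0 < s < S -> is_derive s 1 (F j) (dF j s).
  move=> sS; apply: (@is_derive_sum_fun j
    (fun k s => om k * (y k s ^+ 2 + c s * (lam k ^+ 2 * x k s ^+ 2)))
    (fun k => om k * (dc s * (lam k ^+ 2 * x k s ^+ 2)
                      - 2 * d s * (lam k ^+ 2 * p k s) * y k s))) => k.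
  have ? := dx k s sS; have ? := dy k s sS; have ? := ddc s sS.
  by apply: is_derive_eq; rewrite /GRing.scale/=; ring.
have cF j : {within `[0, S], continuous (F j)}.
  apply: (@within_sum_continuous _ j
    (fun k s => om k * (y k s ^+ 2 + c s * (lam k ^+ 2 * x k s ^+ 2)))) => k s.
  apply: cvgM; first exact: cvg_cst.
  apply: cvgD; first by apply: cvgM; exact: cy.
  apply: cvgM; first exact: cc.
  by apply: cvgM; [exact: cvg_cst|apply: cvgM; exact: cx].
have dFle j s b' : 0 < s < S -> (forall k, F k s <= b') -> dF j s <= C * b'.
  move=> sS Fb'.
  have sS' : 0 <= s <= S by case/andP: sS => /ltW -> /ltW ->.
  have nuc : nu <= c s by case/andP: (cb s sS').
  have d2 : d s ^+ 2 <= D * (b' / nu).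
    apply: dD => // i; rewrite ler_pdivlMr//; apply: le_trans (Fb' i).
    rewrite mulr_suml; apply: ler_sum => k _.
    rewrite -mulrA; apply: ler_wpM2l => //.
    rewrite -[leLHS]add0r lerD ?sqr_ge0// mulrC.
    exact: ler_wpM2r.
  have step k : om k * (dc s * (lam k ^+ 2 * x k s ^+ 2)
     - 2 * d s * (lam k ^+ 2 * p k s) * y k s) <=
     (K / nu + 1) * (om k * (y k s ^+ 2 + c s * (lam k ^+ 2 * x k s ^+ 2)))
     + d s ^+ 2 * (om k * (lam k ^+ 4 * p k s ^+ 2)).
    rewrite [X in _ <= X + _]mulrCA [X in _ <= _ + X]mulrCA -mulrDr; apply: ler_wpM2l => //.
    set X := lam k ^+ 2 * x k s ^+ 2.
    have -> : lam k ^+ 4 * p k s ^+ 2 = (lam k ^+ 2 * p k s) ^+ 2 by ring.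
    set Z := lam k ^+ 2 * p k s.
    have h1 : dc s * X <= K / nu * (c s * X).
      apply: le_trans (_ : K * X <= _).
        by apply: ler_wpM2r; [exact: lx0|apply: le_trans (dcK s sS); exact: ler_norm].
      rewrite mulrA; apply: ler_wpM2r; first exact: lx0.
      by rewrite -mulrA ler_peMr// ler_pdivlMl// mulr1.
    have h2 : - (2 * d s * Z * y k s) <= y k s ^+ 2 + d s ^+ 2 * Z ^+ 2.
      have := sqr_ge0 (y k s + d s * Z); nra.
    have h3 : 0 <= K / nu * y k s ^+ 2 by rewrite mulr_ge0 ?sqr_ge0// divr_ge0// ltW.
    have h4 : 0 <= c s * X by rewrite mulr_ge0//; [lra|exact: lx0].
    nra.
  apply: le_trans (ler_sum _ (fun k _ => step (nat_of_ord k))) _.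
  rewrite big_split/= -!mulr_sumr.
  have -> : C * b' = (K / nu + 1) * b' + D * P / nu * b' by rewrite /C; ring.
  apply: lerD.
    apply: ler_wpM2l; last exact: Fb'.
    by rewrite addr_ge0// divr_ge0// ltW.
  apply: le_trans (ler_wpM2l (sqr_ge0 _) (pP j s sS)) _.
  apply: le_trans (ler_wpM2r P0 d2) _.
  by rewrite le_eqVlt; apply/orP; left; apply/eqP; field; rewrite gt_eqF.
have Fb0 j : F j 0 <= (1 + m1) * b.
  apply: le_trans (FE j 0 _) _; first by rewrite lexx.
  by apply: ler_wpM2l => //; lra.
have FB j s : 0 <= s <= S -> 0 <= F j s <= (1 + m1) * B.
  move=> sS; rewrite F0//=; apply: le_trans (FE j s sS) _.
  by apply: ler_wpM2l; [lra|exact: EB].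
have Gt := gronwall_sup C0 derF cF FB dFle Fb0 n tS.
have i0 : 0 <= 1 + nu^-1 by rewrite addr_ge0// invr_ge0 ltW.
apply: le_trans (EF n t tS) _.
apply: le_trans (ler_wpM2l i0 Gt) _.
have b0 : 0 <= b by have := Eb 0%N; rewrite /mode_energy big_ord0.
set m2 := 1 + m1; set n2 := 1 + nu^-1 in i0 *.
have B0 : 0 <= 2 * (m2 * n2 * b) by rewrite !mulr_ge0// addr_ge0.
have -> : n2 * (2 * expR (2 * C * t) * (m2 * b)) =
          2 * (m2 * n2 * b) * expR (2 * C * t) by ring.
have -> : 2 * expR (2 * C * T) * m2 * n2 * b =
          2 * (m2 * n2 * b) * expR (2 * C * T) by ring.
apply: ler_wpM2l => //.
rewrite ler_expR; apply: ler_wpM2l; first by rewrite mulr_ge0// ltW.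
by case/andP: tS => _ /le_trans; apply.
Qed.

End modes.

(** * Limits and derivatives relative to an interval *)

Section epsilon_delta.
Context {R : realType} {V : normedModType R}.
Implicit Types (I : set R) (g : R -> V) (t : R) (l : V).

Lemma cvg_within_dnbhsP I g t l :
  g s @[s --> within I t^'] --> l <->
  forall e, 0 < e -> exists2 d, 0 < d &
    forall s, `|s - t| < d -> s != t -> I s -> `|l - g s| < e.
Proof.
split=> [/cvgrPdist_lt gl e e0|H].
  have /nbhs_ballP[d d0 dP] := gl e e0.
  exists d => // s sd st Is; apply: dP => //.
  by rewrite /ball/= distrC.
apply/cvgrPdist_lt => e e0; have [d d0 dP] := H e e0.
apply/nbhs_ballP; exists d => // s; rewrite /ball/= distrC => sd st Is.
exact: dP.
Qed.

Lemma cvg_within_nbhsP I g t l :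
  g s @[s --> within I (nbhs t)] --> l <->
  forall e, 0 < e -> exists2 d, 0 < d &
    forall s, `|s - t| < d -> I s -> `|l - g s| < e.
Proof.
split=> [/cvgrPdist_lt gl e e0|H].
  have /nbhs_ballP[d d0 dP] := gl e e0.
  exists d => // s sd Is; apply: dP => //.
  by rewrite /ball/= distrC.
apply/cvgrPdist_lt => e e0; have [d d0 dP] := H e e0.
apply/nbhs_ballP; exists d => // s; rewrite /ball/= distrC => sd Is.
exact: dP.
Qed.

Lemma cvg_within_dnbhs I g t l :
  g s @[s --> within I (nbhs t)] --> l -> g s @[s --> within I t^'] --> l.
Proof.
move=> /cvg_within_nbhsP gl; apply/cvg_within_dnbhsP => e e0.
by have [d d0 dP] := gl e e0; exists d => // s sd _; exact: dP.
Qed.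

Lemma within_continuousP I g :
  {within I, continuous g} <->
  forall t, I t -> forall e, 0 < e -> exists2 d, 0 < d &
    forall s, `|s - t| < d -> I s -> `|g t - g s| < e.
Proof.
split=> [/subspace_continuousP gc t It|H].
  by apply/cvg_within_nbhsP; exact: gc.
by apply/subspace_continuousP => t It; apply/cvg_within_nbhsP; exact: H.
Qed.

Lemma cvg_dnbhsP g t l :
  g s @[s --> t^'] --> l <->
  forall e, 0 < e -> exists2 d, 0 < d &
    forall s, `|s - t| < d -> s != t -> `|l - g s| < e.
Proof.
split=> [/cvgrPdist_lt gl e e0|H].
  have /nbhs_ballP[d d0 dP] := gl e e0.
  exists d => // s sd st; apply: dP => //.
  by rewrite /ball/= distrC.
apply/cvgrPdist_lt => e e0; have [d d0 dP] := H e e0.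
apply/nbhs_ballP; exists d => // s; rewrite /ball/= distrC => sd st.
exact: dP.
Qed.

Lemma cvg_within_interior I g t l (r : R) : 0 < r ->
  (forall s, `|s - t| < r -> I s) ->
  g s @[s --> within I t^'] --> l -> g s @[s --> t^'] --> l.
Proof.
move=> r0 rI /cvg_within_dnbhsP gl; apply/cvg_dnbhsP => e e0.
have [d d0 dP] := gl e e0; exists (Num.min r d) => [|s].
  by rewrite lt_min r0.
by rewrite lt_min => /andP[sr sd] st; apply: dP => //; exact: rI.
Qed.

Lemma diff_quot_continuous I g t l :
  diff_quot g t s @[s --> within I t^'] --> l ->
  forall e, 0 < e -> exists2 d, 0 < d &
    forall s, `|s - t| < d -> I s -> `|g t - g s| < e.
Proof.
move=> /cvg_within_dnbhsP gl e e0.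
have [d d0 dP] := gl 1 ltr01.
have l0 : 0 < `|l| + 1 by rewrite ltr_wpDl.
exists (Num.min d (e / (`|l| + 1))) => [|s].
  by rewrite lt_min d0 divr_gt0.
rewrite lt_min => /andP[sd se] Is.
have [->|st] := eqVneq s t; first by rewrite subrr normr0.
have := dP s sd st Is; set q := diff_quot _ _ _ => lq.
have st0 : s - t != 0 by rewrite subr_eq0.
have -> : g t - g s = - ((s - t) *: q).
  by rewrite /q /diff_quot scalerA mulfV// scale1r opprB.
rewrite normrN normrZ.
have qle : `|q| <= `|l| + 1.
  by rewrite -[q](subKr l) (le_trans (ler_normB _ _))// lerD2l ltW.
apply: le_lt_trans (_ : `|s - t| * (`|l| + 1) < _); first exact: ler_wpM2l.
by rewrite -ltr_pdivlMr.
Qed.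

End epsilon_delta.

Lemma eq_cvg_to (I : Type) (V : topologicalType) (F : set_system I) (f g : I -> V) (l : V) :
  f =1 g -> f @ F --> l -> g @ F --> l.
Proof. by move=> /funext ->. Qed.

Lemma eq_cvg_within {R : realType} (V : normedModType R) (I : set R)
    (f g : R -> V) (t : R) (l : V) :
  (forall s, I s -> s != t -> f s = g s) ->
  f s @[s --> within I t^'] --> l -> g s @[s --> within I t^'] --> l.
Proof.
move=> fg /cvg_within_dnbhsP fl; apply/cvg_within_dnbhsP => eps eps0.
have [d d0 dP] := fl eps eps0; exists d => // s sd st Is.
by rewrite -fg//; exact: dP.
Qed.

(** * Nonlinearities of class C1 on the half-line *)

Section C1_nonlinearity.
Context {R : realType}.
Implicit Types (f m : R -> R).

Lemma diff_quot_is_derive f (t d : R) :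
  diff_quot f t s @[s --> t^'] --> d -> is_derive t 1 f d.
Proof.
move=> fd.
have shiftt : (fun h : R => h + t) @ 0^' --> t^'.
  move=> A; rewrite /dnbhs /within/= => /nbhs_ballP[e e0 eA].
  apply/nbhs_ballP; exists e => // h /= h_e h0; apply: eA.
    by move: h_e; rewrite /ball/= sub0r normrN opprD addrCA subrr addr0 normrN.
  by apply: contra h0 => /eqP ht; apply/eqP/(addIr t); rewrite ht add0r.
have := cvg_comp _ _ shiftt fd.
rewrite (_ : diff_quot f t \o _ =
    fun h => h^-1 *: ((f \o shift t) (h *: 1) - f t)); last first.
  by apply/funext => h; rewrite /diff_quot /= addrK /GRing.scale/= mulr1.
move=> fd'; apply: DeriveDef; first by apply/cvg_ex; exists d.
by rewrite /derive; exact: cvg_lim fd'.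
Qed.

Lemma is_derive_diff_quot f (t d : R) :
  is_derive t 1 f d -> diff_quot f t s @[s --> t^'] --> d.
Proof.
move=> [fd dE].
have shiftt : (fun h : R => h - t) @ t^' --> 0^'.
  move=> A; rewrite /dnbhs /within/= => /nbhs_ballP[e e0 eA].
  apply/nbhs_ballP; exists e => // h /= h_e h0; apply: eA.
    by move: h_e; rewrite /ball/= sub0r normrN distrC.
  by rewrite subr_eq0.
have : (fun h => h^-1 *: ((f \o shift t) (h *: 1) - f t)) @ 0^' --> d.
  by rewrite -dE; exact: fd.
move=> /(cvg_comp _ _ shiftt); apply: cvg_trans.
rewrite (_ : _ \o _ = diff_quot f t)//; apply/funext => h /=.
by rewrite /diff_quot /GRing.scale/= mulr1 subrK.
Qed.

Lemma C1_lipschitz m (M : R) : C1_on `[0, +oo[ m -> 0 <= M ->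
  exists2 L : R, 0 <= L &
    [/\ forall a, 0 <= a <= M -> m a <= L,
        forall a, 0 <= a <= M -> `|deriv_on `[0, +oo[ m a| <= L
      & forall a b, 0 <= a <= M -> 0 <= b <= M ->
          `|m a - m b| <= L * `|a - b|].
Proof.
move=> [mD mC] M0.
have sub : `[0, M] `<=` `[0, +oo[%classic.
  by move=> x /=; rewrite !in_itv/= => /andP[->].
have cm : {within `[0, M], continuous m}.
  apply: continuous_subspaceW sub _; apply/within_continuousP => x x0.
  exact: diff_quot_continuous (mD x x0).
have cd : {within `[0, M], continuous (fun x => `|deriv_on `[0, +oo[ m x|)}.
  have cd := continuous_subspaceW sub mC.
  by move=> x; apply: cvg_norm; exact: cd.
have [a1 _ ma1] := EVT_max M0 cm.
have [a2 _ ma2] := EVT_max M0 cd.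
pose L := `|m a1| + `|deriv_on `[0, +oo[ m a2|.
have L0 : 0 <= L by rewrite addr_ge0.
have dL a : 0 <= a <= M -> `|deriv_on `[0, +oo[ m a| <= L.
  by move=> aM; apply: le_trans (ma2 a _) _; rewrite ?in_itvcc// lerDr.
exists L => //; split => //.
  move=> a aM; apply: le_trans (ma1 a _) _; rewrite ?in_itvcc//.
  by rewrite (le_trans (ler_norm _))// lerDl.
have key a b : 0 <= a -> a < b -> b <= M -> `|m b - m a| <= L * `|b - a|.
  move=> a0 ab bM.
  have dm x : x \in `]a, b[ -> is_derive x 1 m (deriv_on `[0, +oo[ m x).
    rewrite in_itv/= => /andP[ax xb].
    have x0 : 0 < x by exact: le_lt_trans ax.
    apply: diff_quot_is_derive.
    have xI : `[0, +oo[%classic x by rewrite /= in_itv/= andbT ltW.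
    apply: (cvg_within_interior x0 _ (mD x xI)) => s.
    by rewrite ltr_distl subrr /= in_itv/= andbT => /andP[/ltW].
  have cab : {within `[a, b], continuous m}.
    apply: continuous_subspaceW cm => x /=; rewrite !in_itv/= => /andP[ax xb].
    by rewrite (le_trans a0 ax) (le_trans xb bM).
  have [x] := MVT ab dm cab; rewrite in_itv/= => /andP[ax xb] ->.
  rewrite normrM; apply: ler_wpM2r => //; apply: dL.
  by rewrite (le_trans a0 (ltW ax)) (le_trans (ltW xb) bM).
move=> a b /andP[a0 aM] /andP[b0 bM].
case: (ltgtP a b) => [ab|ab|->]; last by rewrite !subrr normr0 mulr0.
  by rewrite distrC [in leRHS]distrC; exact: key.
exact: key.
Qed.

(** Where f vanishes, m has only a one-sided derivative, so the usual chain rule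
    does not apply. The Caratheodory slope of m at f t, extended by the derivative
    at the points where f s = f t, is continuous along f because f stays in the
    half-line. *)
Lemma C1_comp_is_derive m f (t df : R) : C1_on `[0, +oo[ m ->
  (forall s, 0 <= f s) -> is_derive t 1 f df ->
  is_derive t 1 (fun s => m (f s)) (deriv_on `[0, +oo[ m (f t) * df).
Proof.
move=> [mD _] f0 fdf.
have ft : `[0, +oo[%classic (f t) by rewrite /= in_itv/= andbT.
set m' := deriv_on _ m _.
pose slope s := if f s == f t then m' else diff_quot m (f t) (f s).
have fc : {for t, continuous f} by exact: is_derive_continuous.
have slopec : slope @ t^' --> m'.
  apply/cvg_dnbhsP => e e0.
  have /cvg_within_dnbhsP/(_ e e0)[d d0 dP] := mD _ ft.
  have [r r0 rP] : exists2 r, 0 < r & forall s, `|s - t| < r -> `|f s - f t| < d.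
    have /cvgrPdist_lt/(_ d d0)/nbhs_ballP[r r0 rP] := fc.
    by exists r => // s; rewrite distrC [X in X < d]distrC; exact: rP.
  exists r => // s sr st; rewrite /slope; case: eqP => [_|/eqP fst].
    by rewrite subrr normr0.
  by apply: dP => //; [exact: rP|rewrite /= in_itv/= andbT].
apply: diff_quot_is_derive.
have := cvgM slopec (is_derive_diff_quot fdf).
rewrite (_ : slope \* _ = diff_quot (fun s => m (f s)) t); first by apply.
apply/funext => s; rewrite /slope /diff_quot /GRing.scale/=.
case: eqP => [->|/eqP fst]; first by rewrite !subrr !mulr0.
by rewrite mulrCA [X in _ * X]mulrAC mulVf ?mul1r// subr_eq0.
Qed.

End C1_nonlinearity.

(** * Solutions seen through their modes *)

Section modal_solutions.
Context {R : realType}.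
Implicit Types (m : R -> R) (lam om : nat -> R) (S T M : R).

(** An energy bound phrased on partial sums, so that no summability is to be
    carried along. *)
Definition energy_le lam (x y : nat -> R) (b : R) : Prop :=
  forall n, mode_energy lam (fun k => 1 + lam k) n x y <= b.

(** The coordinates of a solution in the eigenbasis. The function s is the square
    norm of A^(1/2) u, the argument of m; its derivative ds is twice the scalar
    product of A^(1/4) u' and A^(3/4) u, whence the bound by the energy. Both are
    parameters, since the differentiability of s comes from the space H and not
    from its series. *)
Record modal_solution m lam S (x y : nat -> R -> R) (s ds : R -> R) : Prop :=
  ModalSolution {
    modal_x : forall k t, 0 < t < S -> is_derive t 1 (x k) (y k t);
    modal_y : forall k t, 0 < t < S ->
      is_derive t 1 (y k) (- (m (s t) * (lam k ^+ 2 * x k t)));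
    modal_s : forall t, 0 < t < S -> is_derive t 1 s (ds t);
    modal_cx : forall k, {within `[0, S], continuous (x k)};
    modal_cy : forall k, {within `[0, S], continuous (y k)};
    modal_cs : {within `[0, S], continuous s};
    modal_s_ge0 : forall t, 0 <= s t;
    modal_sE : forall t, 0 <= t <= S ->
      \sum_(k < n) lam k ^+ 2 * x k t ^+ 2 @[n --> \oo] --> s t;
    modal_ds : forall t b, 0 < t < S ->
      energy_le lam (x^~ t) (y^~ t) b -> `|ds t| <= b }.

Lemma mode_energy_weight_le lam (om om' : nat -> R) n (x y : nat -> R) :
  (forall k, om k <= om' k) -> mode_energy lam om n x y <= mode_energy lam om' n x y.
Proof.
move=> omle; apply: ler_sum => k _; apply: ler_wpM2r => //.
by apply: addr_ge0; [|apply: mulr_ge0]; exact: sqr_ge0.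
Qed.

Lemma mode_energyB_le lam om n (x y x' y' : nat -> R) : (forall k, 0 <= om k) ->
  mode_energy lam om n (fun k => x k - x' k) (fun k => y k - y' k) <=
  2 * (mode_energy lam om n x y + mode_energy lam om n x' y').
Proof.
move=> om0; rewrite -big_split/= mulr_sumr; apply: ler_sum => k _.
rewrite -mulrDr [leRHS]mulrCA; apply: ler_wpM2l => //.
have := mulr_ge0 (sqr_ge0 (lam k)) (sqr_ge0 (x k + x' k)).
have := sqr_ge0 (y k + y' k); nra.
Qed.

(** Induction on n: the cross term 2 s u v is bounded by A v^2 + B u^2 since
    s^2 <= A B. *)
Lemma sum_cauchy_schwarz n (a b : nat -> R) :
  (\sum_(k < n) a k * b k) ^+ 2 <=
  (\sum_(k < n) a k ^+ 2) * (\sum_(k < n) b k ^+ 2).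
Proof.
elim: n => [|n IHn]; first by rewrite !big_ord0 expr0n/= mulr0.
rewrite !big_ord_recr/=.
have A0 : 0 <= \sum_(k < n) a k ^+ 2 by apply: sumr_ge0 => k _; exact: sqr_ge0.
have B0 : 0 <= \sum_(k < n) b k ^+ 2 by apply: sumr_ge0 => k _; exact: sqr_ge0.
move: IHn A0 B0; set s := \sum_(k < n) a k * b k.
set A := \sum_(k < n) _; set B := \sum_(k < n) _ => IHn A0 B0.
move: (a n) (b n) => u v.
suff : 2 * s * (u * v) <= A * v ^+ 2 + B * u ^+ 2 by move: IHn; nra.
have w0 : 0 <= A * v ^+ 2 + B * u ^+ 2 by rewrite addr_ge0// mulr_ge0// sqr_ge0.
apply: le_trans (ler_norm _) _.
rewrite -(@ler_pXn2r _ 2) ?nnegrE// real_normK ?num_real//.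
have : s ^+ 2 * (u * v) ^+ 2 <= A * B * (u * v) ^+ 2 by rewrite ler_wpM2r// sqr_ge0.
have := sqr_ge0 (A * v ^+ 2 - B * u ^+ 2); nra.
Qed.

(** The difference s' - s is the sum of lam^2 (q - p) (q + p); the weights om and
    1 / om are distributed over the two factors by the Cauchy-Schwarz inequality.
    A weak norm of the difference q - p is thus enough, at the price of a strong
    norm of q + p. *)
Lemma sqr_energy_gap_le lam om (x p q : nat -> R) (s s' b Q : R) :
  (forall k, 0 < om k) -> (forall k, x k = q k - p k) ->
  \sum_(k < n) lam k ^+ 2 * p k ^+ 2 @[n --> \oo] --> s ->
  \sum_(k < n) lam k ^+ 2 * q k ^+ 2 @[n --> \oo] --> s' ->
  (forall n, \sum_(k < n) om k * (lam k ^+ 2 * x k ^+ 2) <= b) ->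
  (forall n, \sum_(k < n) (om k)^-1 * (lam k ^+ 2 * (p k + q k) ^+ 2) <= Q) ->
  (s' - s) ^+ 2 <= b * Q.
Proof.
move=> om0 xE ps qs xb pqQ.
have dcvg : (\sum_(k < n) lam k ^+ 2 * q k ^+ 2
             - \sum_(k < n) lam k ^+ 2 * p k ^+ 2) ^+ 2 @[n --> \oo] --> (s' - s) ^+ 2.
  apply: cvgM; exact: cvgB.
apply: (cvgr_to_le dcvg); apply: nearW => n.
rewrite -sumrB.
have -> : \sum_(i < n) (lam i ^+ 2 * q i ^+ 2 - lam i ^+ 2 * p i ^+ 2) =
    \sum_(i < n) (Num.sqrt (om i) * (lam i * x i)) *
                 (Num.sqrt (om i)^-1 * (lam i * (p i + q i))).
  apply: eq_bigr => i _; rewrite xE [in RHS]mulrACA.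
  have -> : Num.sqrt (om i) * Num.sqrt (om i)^-1 = 1.
    by rewrite -sqrtrM ?(ltW (om0 i))// mulfV ?gt_eqF// sqrtr1.
  by ring.
apply: le_trans (sum_cauchy_schwarz n (fun i => Num.sqrt (om i) * (lam i * x i))
  (fun i => Num.sqrt (om i)^-1 * (lam i * (p i + q i)))) _.
have sq (c r : R) : 0 <= c -> (Num.sqrt c * r) ^+ 2 = c * r ^+ 2.
  by move=> c0; rewrite exprMn sqr_sqrtr.
apply: ler_pM; [by apply: sumr_ge0 => i _; exact: sqr_ge0|
  by apply: sumr_ge0 => i _; exact: sqr_ge0| |].
  apply: le_trans (xb n); apply: ler_sum => i _.
  by rewrite sq ?(ltW (om0 i))// exprMn.
apply: le_trans (pqQ n); apply: ler_sum => i _.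
by rewrite sq ?invr_ge0 ?(ltW (om0 i))// exprMn.
Qed.

Lemma energy_le_s lam (x y : nat -> R) (s b : R) : (forall k, 0 <= lam k) ->
  \sum_(k < n) lam k ^+ 2 * x k ^+ 2 @[n --> \oo] --> s ->
  energy_le lam x y b -> s <= b.
Proof.
move=> lam0 xs xyb; apply: (cvgr_to_le xs); apply: nearW => n.
apply: le_trans (xyb n); apply: ler_sum => k _.
have h1 : 0 <= lam k ^+ 2 * x k ^+ 2 by apply: mulr_ge0; exact: sqr_ge0.
have h2 := sqr_ge0 (y k); have h3 := lam0 k; nra.
Qed.

Variables (m : R -> R) (lam : nat -> R) (nu0 : R).
Hypothesis lam0 : forall k, 0 <= lam k.
Hypothesis C1m : C1_on `[0, +oo[ m.
Hypothesis nu0_gt0 : 0 < nu0.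
Hypothesis m_ge : forall sigma, 0 <= sigma -> nu0 <= m sigma.

Section coefficient.
Variables (S M : R) (x y : nat -> R -> R) (s ds : R -> R).
Hypothesis sol : modal_solution m lam S x y s ds.
Hypothesis enM : forall t, 0 <= t <= S -> energy_le lam (x^~ t) (y^~ t) M.

Lemma modal_s_le t : 0 <= t <= S -> 0 <= s t <= M.
Proof.
move=> tS; rewrite (modal_s_ge0 sol)/=.
exact: energy_le_s (modal_sE sol tS) (enM tS).
Qed.

Lemma modal_coef_continuous : {within `[0, S], continuous (fun t => m (s t))}.
Proof.
have mc x0 : 0 <= x0 -> forall e, 0 < e -> exists2 d, 0 < d &
    forall z, `|z - x0| < d -> 0 <= z -> `|m x0 - m z| < e.
  move=> x00 e e0; have xI : `[0, +oo[%classic x0 by rewrite /= in_itv/= andbT.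
  have [d d0 dP] := diff_quot_continuous (C1m.1 x0 xI) e0.
  by exists d => // z zd z0; apply: dP => //; rewrite /= in_itv/= andbT.
apply/within_continuousP => t tS e e0.
have [d d0 dP] := mc (s t) (modal_s_ge0 sol t) e e0.
have /within_continuousP/(_ t tS d d0)[r r0 rP] := modal_cs sol.
exists r => // z zr zS; apply: dP; last exact: (modal_s_ge0 sol).
by rewrite distrC; exact: rP.
Qed.

Lemma modal_coef_is_derive t : 0 < t < S ->
  is_derive t 1 (fun t => m (s t)) (deriv_on `[0, +oo[ m (s t) * ds t).
Proof.
by move=> tS; apply: C1_comp_is_derive C1m (modal_s_ge0 sol) (modal_s sol tS).
Qed.

End coefficient.


Lemma mode_energy_pick k n (x y : nat -> R) : (k < n)%N ->
  mode_energy lam (fun j => (j == k)%:R) n x y = y k ^+ 2 + lam k ^+ 2 * x k ^+ 2.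
Proof.
move=> kn; rewrite /mode_energy (bigD1 (Ordinal kn))//= eqxx mul1r.
rewrite big1 ?addr0// => i ik; rewrite (_ : (nat_of_ord i == k) = false) ?mul0r//.
by apply/negbTE; apply: contra ik => /eqP ik; apply/eqP/val_inj.
Qed.

Lemma mode_energy_pick_le k n (x y : nat -> R) :
  mode_energy lam (fun j => (j == k)%:R) n x y <= y k ^+ 2 + lam k ^+ 2 * x k ^+ 2.
Proof.
case: (ltnP k n) => kn; first by rewrite mode_energy_pick.
rewrite /mode_energy big1 => [|i _].
  by apply: addr_ge0; [|apply: mulr_ge0]; exact: sqr_ge0.
by rewrite (ltn_eqF (leq_trans (ltn_ord i) kn)) mul0r.
Qed.

(** All modes solve linear equations with the same coefficient, whose logarithmic
    derivative is bounded in terms of m and of the energy bound M. The growth factor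
    is therefore uniform in the frequency: a high-frequency tail at time t is
    controlled by the same tail at time 0, and any further summability of the data
    persists. *)
Lemma mode_growth M T : 0 <= M -> exists2 G, 0 < G &
  forall S x y s ds, S <= T -> modal_solution m lam S x y s ds ->
  (forall t, 0 <= t <= S -> energy_le lam (x^~ t) (y^~ t) M) ->
  forall k t, 0 <= t <= S ->
    y k t ^+ 2 + lam k ^+ 2 * x k t ^+ 2 <=
    G * (y k 0 ^+ 2 + lam k ^+ 2 * x k 0 ^+ 2).
Proof.
move=> M0; have [L L0 [mL dmL _]] := C1_lipschitz C1m M0.
have i0 : 0 < 1 + nu0^-1 by rewrite addr_gt0// invr_gt0.
pose G : R := 2 * expR (2 * (L * M / nu0 + 1 + 0 * 0 / nu0) * T) * (1 + L) * (1 + nu0^-1).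
exists G => [|S x y s ds ST sol enM k t tS].
  by rewrite !mulr_gt0// ?expR_gt0// ltr_wpDr.
have sle := modal_s_le sol enM.
suff : mode_energy lam (fun j => (j == k)%:R) k.+1 (x^~ t) (y^~ t) <=
    G * (y k 0 ^+ 2 + lam k ^+ 2 * x k 0 ^+ 2) by rewrite mode_energy_pick.
apply: (@forced_mode_energy_le R S T (L * M) nu0 L 0 0 M lam
  (fun j => (j == k)%:R) x y (fun=> fun=> 0) (fun t => m (s t))
  (fun t => deriv_on `[0, +oo[ m (s t) * ds t) (fun=> 0)) => //.
- exact: mulr_ge0.
- exact: (modal_x sol).
- by move=> j z zS; rewrite mul0r subr0; exact: (modal_y sol).
- by move=> z zS; exact: (modal_coef_is_derive sol zS).
- exact: (modal_cx sol).
- exact: (modal_cy sol).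
- exact: modal_coef_continuous sol.
- by move=> z zS; have /andP[s0 sM] := sle z zS; rewrite m_ge// mL// s0.
- move=> z zS; have zS' : 0 <= z <= S by case/andP: zS => /ltW -> /ltW ->.
  rewrite normrM; apply: ler_pM => //; first by apply: dmL; exact: sle.
  exact: (modal_ds sol zS (enM z zS')).
- move=> n z zS; apply: le_trans (enM z zS n); apply: mode_energy_weight_le => j.
  by apply: le_trans (_ : 1 <= _); [case: eqP|rewrite lerDl].
- by move=> z b _ _; rewrite expr0n/= mul0r.
- by move=> n z _; rewrite big1// => i _; rewrite expr0n/= !mulr0.
- by move=> n; exact: mode_energy_pick_le.
Qed.

(** The difference of two solutions satisfies a closed estimate in the weight om
    as soon as the sum of om lam^4 p^2 is bounded. For om = 1 / (1 + lam) the
    energy bound on p suffices, and this gives Lipschitz dependence in a weaker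
    norm for all data; for om = 1 + lam one needs one more power of lam, that is,
    the more regular data. The condition on 1 / om makes the difference of the
    coefficients a Lipschitz function of the om-energy. *)
Lemma weighted_difference_growth M T P : 0 <= M -> 0 <= P -> exists2 G, 0 < G &
  forall om S p r s ds q v s' ds', S <= T ->
  (forall k, 0 < om k) -> (forall k, om k <= 1 + lam k) ->
  (forall k, (om k)^-1 <= 1 + lam k) ->
  modal_solution m lam S p r s ds -> modal_solution m lam S q v s' ds' ->
  (forall t, 0 <= t <= S -> energy_le lam (p^~ t) (r^~ t) M) ->
  (forall t, 0 <= t <= S -> energy_le lam (q^~ t) (v^~ t) M) ->
  (forall n t, 0 < t < S -> \sum_(k < n) om k * (lam k ^+ 4 * p k t ^+ 2) <= P) ->
  forall b, (forall n, mode_energy lam om n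
    (fun k => q k 0 - p k 0) (fun k => v k 0 - r k 0) <= b) ->
  forall n t, 0 <= t <= S -> mode_energy lam om n
    (fun k => q k t - p k t) (fun k => v k t - r k t) <= G * b.
Proof.
move=> M0 P0; have [L L0 [mL dmL lipL]] := C1_lipschitz C1m M0.
have i0 : 0 < 1 + nu0^-1 by rewrite addr_gt0// invr_gt0.
pose D := L ^+ 2 * (4 * M).
pose G : R := 2 * expR (2 * (L * M / nu0 + 1 + D * P / nu0) * T) * (1 + L) * (1 + nu0^-1).
exists G => [|om S p r s ds q v s' ds' ST om0 omle omVle solu solv enu env pP b Eb n t tS].
  by rewrite !mulr_gt0// ?expR_gt0// ltr_wpDr.
have sle := modal_s_le solu enu; have sle' := modal_s_le solv env.
have in_S z : 0 < z < S -> 0 <= z <= S by case/andP => /ltW -> /ltW ->.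
(* The parallelogram inequality; 4 * M is the constant Q of the energy gap. *)
have pqM z j : 0 <= z <= S ->
    \sum_(k < j) (1 + lam k) * (lam k ^+ 2 * (p k z + q k z) ^+ 2) <= 4 * M.
  move=> zS; apply: le_trans (_ : 2 * (mode_energy lam (fun k => 1 + lam k) j (p^~ z) (r^~ z)
    + mode_energy lam (fun k => 1 + lam k) j (q^~ z) (v^~ z)) <= _); last first.
    have := enu z zS j; have := env z zS j; lra.
  rewrite -big_split/= mulr_sumr; apply: ler_sum => k _.
  rewrite -mulrDr [leRHS]mulrCA; apply: ler_wpM2l; first by rewrite addr_ge0.
  have := mulr_ge0 (sqr_ge0 (lam k)) (sqr_ge0 (p k z - q k z)).
  have := sqr_ge0 (r k z); have := sqr_ge0 (v k z); nra.
apply: (@forced_mode_energy_le R S T (L * M) nu0 L D P (4 * M) lam om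
  (fun k z => q k z - p k z) (fun k z => v k z - r k z) p (fun t => m (s' t))
  (fun t => deriv_on `[0, +oo[ m (s' t) * ds' t)
  (fun t => m (s' t) - m (s t))) => //.
- exact: mulr_ge0.
- by rewrite mulr_ge0 ?sqr_ge0// mulr_ge0.
- by move=> k; exact: ltW.
- by move=> k z zS; apply: is_deriveB; [exact: (modal_x solv)|exact: (modal_x solu)].
- move=> k z zS; have h1 := modal_y solv k zS; have h2 := modal_y solu k zS.
  by apply: is_derive_eq; ring.
- by move=> z zS; exact: (modal_coef_is_derive solv zS).
- by move=> k z; apply: cvgB; [exact: (modal_cx solv)|exact: (modal_cx solu)].
- by move=> k z; apply: cvgB; [exact: (modal_cy solv)|exact: (modal_cy solu)].
- exact: modal_coef_continuous solv.
- by move=> z zS; have /andP[s0 sM] := sle' z zS; rewrite m_ge// mL// s0.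
- move=> z zS; rewrite normrM; apply: ler_pM => //.
    by apply: dmL; exact: sle' (in_S z zS).
  exact: (modal_ds solv zS (env z (in_S z zS))).
- move=> j z zS; apply: le_trans (mode_energy_weight_le _ _ _ _ omle) _.
  have lam1 k : 0 <= 1 + lam k by rewrite addr_ge0.
  have := mode_energyB_le lam j (q^~ z) (v^~ z) (p^~ z) (r^~ z) lam1.
  have := enu z zS j; have := env z zS j; lra.
- move=> z b' zS b'P; have zS' := in_S z zS.
  have gap : (s' z - s z) ^+ 2 <= b' * (4 * M).
    apply: (@sqr_energy_gap_le lam om (fun k => q k z - p k z) (p^~ z) (q^~ z)) => //.
    + exact: (modal_sE solu).
    + exact: (modal_sE solv).
    + move=> j; apply: le_trans (pqM z j zS'); apply: ler_sum => k _.
      by apply: ler_wpM2r => //; apply: mulr_ge0; exact: sqr_ge0.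
  rewrite /D -mulrA [4 * M * b']mulrC; apply: le_trans (ler_wpM2l (sqr_ge0 L) gap).
  rewrite -exprMn -real_normK ?num_real// -[leRHS]real_normK ?num_real//.
  rewrite ler_pXn2r ?nnegrE// normrM (ger0_norm L0).
  by apply: lipL; [exact: sle'|exact: sle].
Qed.

(** Splitting of the frequencies at an index n. For the modes k < n the energy is
    at most Lam times the weak energy of weight 1 / (1 + lam), whose growth factor
    G' does not depend on n. For the modes k >= n the difference is estimated by
    the two solutions separately, and each tail is at most G times its initial
    value: small for p because its initial energy is finite, and for q because its
    initial data are delta-close to those of p. One first chooses n, then delta;
    delta depends on p only through its initial data. *)
Lemma modes_stable M T (p0 r0 : nat -> R) (eta : R) : 0 <= M -> 0 < eta ->
  energy_le lam p0 r0 M -> exists2 delta, 0 < delta &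
  forall S p r s ds q v s' ds', S <= T ->
  modal_solution m lam S p r s ds -> modal_solution m lam S q v s' ds' ->
  (forall k, p k 0 = p0 k) -> (forall k, r k 0 = r0 k) ->
  (forall t, 0 <= t <= S -> energy_le lam (p^~ t) (r^~ t) M) ->
  (forall t, 0 <= t <= S -> energy_le lam (q^~ t) (v^~ t) M) ->
  energy_le lam (fun k => q k 0 - p k 0) (fun k => v k 0 - r k 0) delta ->
  forall t, 0 <= t <= S ->
    energy_le lam (fun k => q k t - p k t) (fun k => v k t - r k t) eta.
Proof.
move=> M0 eta0 en0.
have [G G0 growth] := mode_growth T M0.
have [G' G'0 weak] := weighted_difference_growth T M0 M0.
pose e0 k := (1 + lam k) * (r0 k ^+ 2 + lam k ^+ 2 * p0 k ^+ 2).
have h0 (a b c : R) : 0 <= a ^+ 2 + b ^+ 2 * c ^+ 2.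
  by apply: addr_ge0; [|apply: mulr_ge0]; exact: sqr_ge0.
have lam1 k : 0 < 1 + lam k by rewrite ltr_wpDr.
have e00 k : 0 <= e0 k by apply: mulr_ge0; [exact: ltW|exact: h0].
(* The tails contribute 6 * G * tau, half of eta. *)
pose tau := eta / (12 * G).
have tau0 : 0 < tau by rewrite divr_gt0// mulr_gt0.
have [n tailn] : exists n, forall N, \sum_(k < N) (if (k < n)%N then 0 else e0 k) <= tau.
  pose X := [set \sum_(k < n) e0 k | n in [set: nat]].
  have supX : has_sup X.
    split; first by exists (\sum_(k < 0) e0 k), 0%N.
    by exists M => _ [n _ <-]; exact: en0.
  have [_ [n _ <-] nX] := sup_adherent tau0 supX.
  exists n => N.
  have nN : \sum_(k < maxn n N) e0 k <= sup X by apply: (ub_le_sup supX.2); exists (maxn n N).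
  apply: le_trans (_ : \sum_(k < maxn n N) e0 k - \sum_(k < n) e0 k <= _); last by lra.
  have cut j : (n <= j)%N -> \sum_(k < j) (if (k < n)%N then e0 k else 0) = \sum_(k < n) e0 k.
    by move=> nj; rewrite (big_ord_widen _ e0 nj) [RHS]big_mkcond.
  rewrite -(cut (maxn n N)) ?leq_maxl// -sumrB.
  rewrite (big_ord_widen (maxn n N) (fun k => if (k < n)%N then 0 else e0 k)) ?leq_maxr//.
  rewrite big_mkcond/=; apply: ler_sum => k _.
  by case: (k < N)%N; case: (k < n)%N; rewrite ?subrr ?subr0.
pose Lam := \sum_(k < n) (1 + lam k) ^+ 2.
have Lam0 : 0 <= Lam by apply: sumr_ge0 => k _; exact: sqr_ge0.
(* Low modes contribute Lam * G' * delta and the tails 4 * G * delta more. *)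
pose delta := eta / (2 * (Lam * G' + 4 * G)).
have den0 : 0 < Lam * G' + 4 * G.
  by rewrite ltr_wpDl ?mulr_gt0// mulr_ge0// ltW.
have delta0 : 0 < delta by rewrite divr_gt0// mulr_gt0.
exists delta => // S p r s ds q v s' ds' ST solu solv p0E r0E enu env enw t tS N.
pose om k := (1 + lam k)^-1.
have om1 k : om k <= 1 by rewrite invf_le1 ?lerDl.
have omle k : om k <= 1 + lam k by apply: le_trans (om1 k) _; rewrite lerDl.
have weakN : mode_energy lam om N (fun k => q k t - p k t) (fun k => v k t - r k t) <= G' * delta.
  apply: (weak om S p r s ds q v s' ds') => //.
  - by move=> k; rewrite invr_gt0.
  - by move=> k; rewrite invrK.
  - move=> j z zS; have zS' : 0 <= z <= S by case/andP: zS => /ltW -> /ltW ->.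
    apply: le_trans (enu z zS' j); apply: ler_sum => k _.
    have h1 : om k * lam k <= 1 by rewrite ler_pdivrMl// mulr1 lerDr.
    have h2 : 0 <= lam k * (lam k ^+ 2 * p k z ^+ 2).
      by rewrite mulr_ge0// mulr_ge0 ?sqr_ge0.
    have h3 : 0 <= lam k ^+ 2 * p k z ^+ 2 by rewrite mulr_ge0 ?sqr_ge0.
    have h4 : om k * (lam k ^+ 4 * p k z ^+ 2) <= lam k * (lam k ^+ 2 * p k z ^+ 2).
      rewrite (_ : om k * _ = om k * lam k * (lam k * (lam k ^+ 2 * p k z ^+ 2))); last by ring.
      by rewrite ler_piMl.
    apply: le_trans h4 _; rewrite mulrDr mulrDl mul1r.
    have h5 : 0 <= (1 + lam k) * r k z ^+ 2 by rewrite mulr_ge0 ?sqr_ge0// ltW.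
    lra.
  - by move=> j; apply: le_trans (enw j); exact: mode_energy_weight_le.
pose tl k := if (k < n)%N then 0 else 1 + lam k.
(* For k < n, the square of 1 + lam k is one of the summands of Lam. *)
have split_om k : 1 + lam k <= Lam * om k + tl k.
  rewrite /tl; case: ltnP => kn; last first.
    by rewrite lerDr mulr_ge0// invr_ge0 ltW.
  rewrite addr0 ler_pdivlMr// -expr2 /Lam (bigD1 (Ordinal kn))//= lerDl.
  by apply: sumr_ge0 => i _; exact: sqr_ge0.
apply: le_trans (mode_energy_weight_le _ _ _ _ split_om) _.
have -> : mode_energy lam (fun k => Lam * om k + tl k) N
    (fun k => q k t - p k t) (fun k => v k t - r k t) =
  Lam * mode_energy lam om N (fun k => q k t - p k t) (fun k => v k t - r k t)
  + mode_energy lam tl N (fun k => q k t - p k t) (fun k => v k t - r k t).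
  by rewrite mulr_sumr -big_split/=; apply: eq_bigr => k _; rewrite mulrDl mulrA.
have tl0 k : 0 <= tl k by rewrite /tl; case: ifP => // _; exact: ltW.
have tailt : mode_energy lam tl N (fun k => q k t - p k t) (fun k => v k t - r k t)
    <= G * (6 * tau + 4 * delta).
  apply: le_trans (mode_energyB_le lam N (q^~ t) (v^~ t) (p^~ t) (r^~ t) tl0) _.
  have gu : mode_energy lam tl N (p^~ t) (r^~ t) <= G * tau.
    apply: le_trans (ler_wpM2l (ltW G0) (tailn N)); rewrite mulr_sumr.
    apply: ler_sum => k _; rewrite /tl; case: ifP => _; first by rewrite mul0r mulr0.
    rewrite /e0 [leRHS]mulrCA; apply: ler_wpM2l; first exact: ltW.
    by rewrite -p0E -r0E; exact: (growth S p r s ds).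
  have gv : mode_energy lam tl N (q^~ t) (v^~ t) <= G * (2 * (tau + delta)).
    apply: le_trans (_ : G * (2 * (\sum_(k < N) (if (k < n)%N then 0 else e0 k)
       + mode_energy lam (fun k => 1 + lam k) N
           (fun k => q k 0 - p k 0) (fun k => v k 0 - r k 0))) <= _);
      last first.
      apply: ler_wpM2l; first exact: ltW.
      by apply: ler_wpM2l => //; apply: lerD; [exact: tailn|exact: enw].
    rewrite -big_split/= 2!mulr_sumr; apply: ler_sum => k _.
    rewrite /tl; case: ifP => _.
      by rewrite mul0r add0r; do 2 (apply: mulr_ge0; first by rewrite // ltW);
         apply: mulr_ge0; [exact: ltW|exact: h0].
    rewrite /e0 -mulrDr [2 * _]mulrCA [leRHS]mulrCA; apply: ler_wpM2l; first exact: ltW.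
    apply: le_trans (growth S q v s' ds' ST solv env k t tS) _.
    apply: ler_wpM2l; first exact: ltW.
    rewrite -p0E -r0E.
    have := mulr_ge0 (sqr_ge0 (lam k)) (sqr_ge0 (q k 0 - 2 * p k 0)).
    have := sqr_ge0 (v k 0 - 2 * r k 0); nra.
  lra.
apply: le_trans (lerD (ler_wpM2l Lam0 weakN) tailt) _.
have -> : Lam * (G' * delta) + G * (6 * tau + 4 * delta) =
  (Lam * G' + 4 * G) * delta + 6 * G * tau by ring.
have -> : (Lam * G' + 4 * G) * delta = eta / 2.
  by rewrite /delta; field; rewrite gt_eqF.
have -> : 6 * G * tau = eta / 2 by rewrite /tau; field; rewrite gt_eqF.
by rewrite -splitr.
Qed.

(** For data with finite energy of weight lam^3 the uniform growth of the modes
    keeps that energy bounded, hence also the sums of lam^4 p^2 and lam^5 p^2. The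
    difference estimate then closes directly in the weight 1 + lam. *)
Lemma regular_modes_lipschitz M T Z (p0 r0 : nat -> R) : 0 <= M ->
  (forall n, mode_energy lam (fun k => lam k ^+ 3) n p0 r0 <= Z) ->
  exists2 G, 0 < G &
  forall S p r s ds q v s' ds', S <= T ->
  modal_solution m lam S p r s ds -> modal_solution m lam S q v s' ds' ->
  (forall k, p k 0 = p0 k) -> (forall k, r k 0 = r0 k) ->
  (forall t, 0 <= t <= S -> energy_le lam (p^~ t) (r^~ t) M) ->
  (forall t, 0 <= t <= S -> energy_le lam (q^~ t) (v^~ t) M) ->
  forall b,
  energy_le lam (fun k => q k 0 - p k 0) (fun k => v k 0 - r k 0) b ->
  forall t, 0 <= t <= S ->
    energy_le lam (fun k => q k t - p k t) (fun k => v k t - r k t) (G * b).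
Proof.
move=> M0 Z0.
have Zge0 : 0 <= Z by have := Z0 0%N; rewrite /mode_energy big_ord0.
have [G G0 growth] := mode_growth T M0.
have P0 : 0 <= M + 2 * (G * Z) by rewrite addr_ge0// !mulr_ge0// ltW.
have [G' G'0 diff] := weighted_difference_growth T M0 P0.
exists G' => // S p r s ds q v s' ds' ST solu solv p0E r0E enu env b enw t tS n.
apply: (diff (fun k => 1 + lam k) S p r s ds q v s' ds') => //.
- by move=> k; rewrite ltr_wpDr.
- by move=> k; apply: le_trans (_ : 1 <= _); rewrite ?invf_le1 ?lerDl// ltr_wpDr.
move=> j z zS; have zS' : 0 <= z <= S by case/andP: zS => /ltW -> /ltW ->.
apply: le_trans (lerD (enu z zS' j) (ler_wpM2l _ (ler_wpM2l (ltW G0) (Z0 j)))) => //.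
rewrite !mulr_sumr -big_split/=; apply: ler_sum => k _.
have := growth S p r s ds ST solu enu k z zS'.
rewrite p0E r0E => /(ler_wpM2l (exprn_ge0 3 (lam0 k))).
set h := r0 k ^+ 2 + _ => gk.
have h1 : lam k ^+ 3 * r k z ^+ 2 >= 0 by apply: mulr_ge0; [exact: exprn_ge0|exact: sqr_ge0].
have h2 : (1 + lam k) * r k z ^+ 2 >= 0 by rewrite mulr_ge0 ?sqr_ge0// addr_ge0.
have l1 : lam k ^+ 4 <= (1 + lam k) * lam k ^+ 2 + lam k ^+ 5.
  have l0 := lam0 k.
  case: (lerP (lam k) 1) => lk.
    have : lam k ^+ 4 <= lam k ^+ 2 by rewrite ler_wiXn2l.
    have := exprn_ge0 5 l0; have := exprn_ge0 3 l0; nra.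
  have : lam k ^+ 4 <= lam k ^+ 5 by rewrite ler_weXn2l// ltW.
  have := exprn_ge0 3 l0; have := sqr_ge0 (lam k); nra.
have h3 := ler_wpM2r (sqr_ge0 (p k z)) l1.
lra.
Qed.

End modal_solutions.

(** * Coordinates in the eigenbasis and powers of the operator *)

Section hilbert.
Context {R : realType} {H : completeNormedModType R}.
Variables (ip : {dot H for idfun}) (e : nat -> H) (lam : nat -> R).
Hypothesis nrm : norm_from_dot ip.
Hypothesis onb : orthonormal_basis ip e.
Hypothesis lam0 : forall k, 0 <= lam k.
Implicit Types (x y z w : H) (a b : R).

Lemma ipC x y : ip x y = ip y x.
Proof. by rewrite hermC expr0 mul1r. Qed.

Lemma ipDl x y z : ip (x + y) z = ip x z + ip y z.
Proof. exact: linearDl. Qed.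

Lemma ipBl x y z : ip (x - y) z = ip x z - ip y z.
Proof. exact: linearBl. Qed.

Lemma ipZl c x z : ip (c *: x) z = c * ip x z.
Proof. exact: linearZl_LR. Qed.

Lemma sqnormD x y : `|x + y| ^+ 2 = `|x| ^+ 2 + `|y| ^+ 2 + 2 * ip x y.
Proof.
by rewrite !nrm !ipDl (ipC x (x + y)) (ipC y (x + y)) !ipDl (ipC y x); ring.
Qed.

Lemma sqnormB x y : `|x - y| ^+ 2 = `|x| ^+ 2 + `|y| ^+ 2 - 2 * ip x y.
Proof.
by rewrite !nrm !ipBl (ipC x (x - y)) (ipC y (x - y)) !ipBl (ipC y x); ring.
Qed.

Lemma ip_polar x y : ip x y = (`|x + y| ^+ 2 - `|x - y| ^+ 2) / 4.
Proof. by rewrite sqnormD sqnormB; field. Qed.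

Lemma ip_cvg (I : Type) (F : set_system I) {FF : Filter F} (f g : I -> H) x y :
  f @ F --> x -> g @ F --> y -> ip (f s) (g s) @[s --> F] --> ip x y.
Proof.
move=> fx gy; under eq_fun do rewrite ip_polar; rewrite ip_polar.
apply: cvgM; last exact: cvg_cst.
by apply: cvgB; apply: cvgM; apply: cvg_norm; [exact: cvgD|exact: cvgD|exact: cvgB|exact: cvgB].
Qed.

Lemma ip_double_le x y : `|2 * ip x y| <= `|x| ^+ 2 + `|y| ^+ 2.
Proof.
have := sqr_ge0 `|x + y|; have := sqr_ge0 `|x - y|; rewrite (sqnormD x y) (sqnormB x y) => ? ?.
by rewrite ler_norml; apply/andP; split; lra.
Qed.

Lemma ip_suml m n (c : nat -> R) z :
  ip (\sum_(m <= k < n) c k *: e k) z = \sum_(m <= k < n) c k * ip (e k) z.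
Proof.
elim: n => [|n IHn]; first by rewrite !big_geq// linear0l.
case: (leqP m n) => mn; last by rewrite !big_geq// linear0l.
by rewrite !big_nat_recr//= ipDl IHn ipZl.
Qed.

Lemma ip_basis_sum m n (c : nat -> R) j :
  ip (\sum_(m <= k < n) c k *: e k) (e j) = (if (m <= j < n)%N then c j else 0).
Proof.
rewrite ip_suml; under eq_bigr do rewrite onb.1.
case: ifP => [mjn|mjn].
  rewrite (bigD1_seq j) ?mem_index_iota ?iota_uniq//= eqxx mulr1 big1 ?addr0//.
  by move=> k kj; rewrite (negbTE kj) mulr0.
rewrite big_nat big1// => k mkn.
by case: eqP => [kj|]; rewrite ?mulr0// -kj mkn in mjn *.
Qed.

Lemma norm_basis_sum m n (c : nat -> R) :
  `|\sum_(m <= k < n) c k *: e k| ^+ 2 = \sum_(m <= k < n) c k ^+ 2.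
Proof.
rewrite nrm ip_suml big_nat [in RHS]big_nat; apply: eq_bigr => k mkn.
by rewrite ipC ip_basis_sum mkn expr2.
Qed.

Lemma parseval x y :
  \sum_(k < n) ip x (e k) * ip y (e k) @[n --> \oo] --> ip x y.
Proof.
apply: eq_cvg_to (ip_cvg (onb.2 x) (cvg_cst y)) => n.
rewrite /series/= ip_suml big_mkord; apply: eq_bigr => k _.
by rewrite (ipC y).
Qed.

Arguments parseval x y : clear implicits.

Lemma parseval_norm x : \sum_(k < n) ip x (e k) ^+ 2 @[n --> \oo] --> `|x| ^+ 2.
Proof.
by rewrite nrm; under eq_fun do under eq_bigr do rewrite expr2; exact: parseval.
Qed.

Arguments parseval_norm x : clear implicits.

Lemma coef_ext x y : (forall k, ip x (e k) = ip y (e k)) -> x = y.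
Proof.
move=> xy; have hx := onb.2 x; have hy := onb.2 y.
have E : series (fun k => ip y (e k) *: e k) = series (fun k => ip x (e k) *: e k).
  by apply/funext => n; apply: eq_bigr => k _; rewrite xy.
by rewrite E in hy; exact: (cvg_unique _ hx hy).
Qed.

Lemma nondecreasing_sum_le (f : nat -> R) (l : R) :
  (forall k, 0 <= f k) -> \sum_(k < n) f k @[n --> \oo] --> l ->
  forall n, \sum_(k < n) f k <= l.
Proof.
move=> f0 fl n; apply: (cvgr_to_ge fl); exists n => // j /= nj.
rewrite (big_ord_widen _ f nj) big_mkcond/=; apply: ler_sum => k _.
by case: ifP.
Qed.

(** Here completeness of the space enters; it makes the limit in the definition
    of the powers of A exist on their domains. *)
Lemma riesz_fischer (c : nat -> R) B : (forall n, \sum_(k < n) c k ^+ 2 <= B) ->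
  exists2 x, series (fun k => c k *: e k) @ \oo --> x & forall k, ip x (e k) = c k.
Proof.
move=> cB.
have cvgc : cvgn (series (fun k => c k ^+ 2)).
  apply: nondecreasing_is_cvgn.
    apply: nondecreasing_series => i _ _; exact: sqr_ge0.
  by exists B => _ [n _ <-]; rewrite /series/= big_mkord; exact: cB.
have : cauchy (series (fun k => c k *: e k) @ \oo).
  apply/cauchy_seriesP => eps eps0.
  have /cvg_cauchy/cauchy_seriesP/(_ (eps ^+ 2)) := cvgc.
  rewrite exprn_gt0// => /(_ isT); apply: filterS => -[m n] /=.
  rewrite ger0_norm; last by apply: sumr_ge0 => i _; exact: sqr_ge0.
  by rewrite -norm_basis_sum ltr_pXn2r// nnegrE// ltW.
move=> /cauchy_cvg/cvg_ex[/= x cx]; exists x => // j.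
have h : ip (series (fun k => c k *: e k) n) (e j) @[n --> \oo] --> ip x (e j).
  exact: ip_cvg cx (cvg_cst (e j)).
have h' : ip (series (fun k => c k *: e k) n) (e j) @[n --> \oo] --> c j.
  apply: cvg_near_cst; exists j.+1 => // n /= jn.
  by rewrite /series/= ip_basis_sum jn.
exact: (cvg_unique _ h h').
Qed.

Lemma domP_bounded a z : domP ip e lam a z <->
  exists B, forall n, \sum_(k < n) (lam k `^ (2 * a) * ip z (e k)) ^+ 2 <= B.
Proof.
have E k : (lam k `^ (2 * a) * ip z (e k)) ^+ 2 = lam k `^ (4 * a) * ip z (e k) ^+ 2.
  rewrite exprMn -powR_mulrn ?powR_ge0// -powRrM; congr (_ `^ _ * _); ring.
have E0 k : 0 <= lam k `^ (4 * a) * ip z (e k) ^+ 2.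
  by rewrite mulr_ge0 ?powR_ge0// sqr_ge0.
split=> [/= zB|[B zB]/=].
  exists (fine (\sum_(0 <= k <oo) (lam k `^ (4 * a) * ip z (e k) ^+ 2)%:E)) => n.
  have s0 : (0 <= \sum_(0 <= k <oo) (lam k `^ (4 * a) * ip z (e k) ^+ 2)%:E)%E.
    by apply: nneseries_ge0 => k _ _; rewrite lee_fin.
  rewrite -lee_fin fineK; last by rewrite ge0_fin_numE.
  under eq_bigr do rewrite E.
  rewrite -sumEFin -(big_mkord xpredT (fun k => (lam k `^ (4 * a) * ip z (e k) ^+ 2)%:E)).
  by apply: nneseries_lim_ge => k _ _; rewrite lee_fin.
apply: le_lt_trans (ltry B); apply: lime_le.
  by apply: is_cvg_nneseries => k _ _; rewrite lee_fin.
apply: nearW => n; rewrite big_mkord sumEFin lee_fin; apply: le_trans (zB n).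
by apply: ler_sum => k _; rewrite E.
Qed.

Lemma powA_coef a z : domP ip e lam a z ->
  forall k, ip (powA ip e lam a z) (e k) = lam k `^ (2 * a) * ip z (e k).
Proof.
move=> /domP_bounded[B zB]; have [x zx xE] :=
  @riesz_fischer (fun k => lam k `^ (2 * a) * ip z (e k)) B zB.
by rewrite /powA (cvg_lim _ zx).
Qed.

Lemma domP_comb a z w (c d : R) : domP ip e lam a z -> domP ip e lam a w ->
  domP ip e lam a (c *: z + d *: w).
Proof.
move=> /domP_bounded[B zB] /domP_bounded[C wC]; apply/domP_bounded.
exists (2 * (c ^+ 2 * B + d ^+ 2 * C)) => n.
apply: le_trans (_ : 2 * (c ^+ 2 * \sum_(k < n) (lam k `^ (2 * a) * ip z (e k)) ^+ 2
  + d ^+ 2 * \sum_(k < n) (lam k `^ (2 * a) * ip w (e k)) ^+ 2) <= _); last first.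
  by apply: ler_wpM2l => //; apply: lerD; apply: ler_wpM2l; rewrite ?sqr_ge0.
rewrite !mulr_sumr -big_split/= mulr_sumr; apply: ler_sum => k _.
rewrite ipDl !ipZl; set l := lam k `^ _.
have := sqr_ge0 (l * (c * ip z (e k)) - l * (d * ip w (e k))); nra.
Qed.

Lemma domPB a z w : domP ip e lam a z -> domP ip e lam a w -> domP ip e lam a (z - w).
Proof.
by move=> hz hw; have := domP_comb 1 (-1) hz hw; rewrite scale1r scaleN1r.
Qed.

Lemma domPD a z w : domP ip e lam a z -> domP ip e lam a w -> domP ip e lam a (z + w).
Proof.
by move=> hz hw; have := domP_comb 1 1 hz hw; rewrite !scale1r.
Qed.

Lemma domPZ a z (c : R) : domP ip e lam a z -> domP ip e lam a (c *: z).
Proof.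
by move=> hz; have := domP_comb c 0 hz hz; rewrite scale0r addr0.
Qed.

Lemma powAB a z w : domP ip e lam a z -> domP ip e lam a w ->
  powA ip e lam a (z - w) = powA ip e lam a z - powA ip e lam a w.
Proof.
move=> hz hw; apply: coef_ext => k.
by rewrite ipBl !powA_coef//; [rewrite ipBl mulrBr|exact: domPB].
Qed.

Lemma powAD a z w : domP ip e lam a z -> domP ip e lam a w ->
  powA ip e lam a (z + w) = powA ip e lam a z + powA ip e lam a w.
Proof.
move=> hz hw; apply: coef_ext => k.
by rewrite ipDl !powA_coef//; [rewrite ipDl mulrDr|exact: domPD].
Qed.

Lemma powAZ a z (c : R) : domP ip e lam a z ->
  powA ip e lam a (c *: z) = c *: powA ip e lam a z.
Proof.
move=> hz; apply: coef_ext => k.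
by rewrite ipZl !powA_coef//; [rewrite ipZl mulrCA|exact: domPZ].
Qed.

Lemma domP_basis a k : domP ip e lam a (e k).
Proof.
apply/domP_bounded; exists ((lam k `^ (2 * a)) ^+ 2) => n.
have E (i : nat) : (lam i `^ (2 * a) * ip (e k) (e i)) ^+ 2 =
    (if i == k then (lam k `^ (2 * a)) ^+ 2 else 0).
  rewrite onb.1 eq_sym; case: eqP => [->|]; first by rewrite mulr1.
  by rewrite mulr0 expr0n.
under eq_bigr do rewrite E.
rewrite -big_mkcond/=.
case: (ltnP k n) => kn.
  by rewrite (big_pred1 (Ordinal kn)).
rewrite big1 ?sqr_ge0// => i /eqP ik.
by move: (ltn_ord i); rewrite ik ltnNge kn.
Qed.

Lemma domP_le a b z : 0 < a -> a <= b -> domP ip e lam b z -> domP ip e lam a z.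
Proof.
move=> a0 ab /domP_bounded[B zB]; apply/domP_bounded.
have xz n : \sum_(k < n) ip z (e k) ^+ 2 <= `|z| ^+ 2.
  exact: (@nondecreasing_sum_le (fun k => ip z (e k) ^+ 2) _
    (fun k => sqr_ge0 _) (parseval_norm z)).
exists (`|z| ^+ 2 + B) => n; apply: le_trans (lerD (xz n) (zB n)).
rewrite -big_split/=; apply: ler_sum => k _.
rewrite !exprMn -[X in _ <= X + _]mul1r -mulrDl; apply: ler_wpM2r; first exact: sqr_ge0.
have b0 : 0 < b by exact: lt_le_trans ab.
case: (lerP (lam k) 1) => lk.
  have l1 : lam k `^ (2 * a) <= 1.
    have a2 : 0 <= 2 * a by rewrite mulr_ge0// ltW.
    by have := @ge0_ler_powR R (2 * a) a2 (lam k) 1; rewrite powR1 !nnegrE; apply.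
  by apply: le_trans (_ : 1 <= _); [rewrite expr_le1// powR_ge0|rewrite lerDl sqr_ge0].
have l1 : lam k `^ (2 * a) <= lam k `^ (2 * b).
  by apply: ler_powR; [exact: ltW|rewrite ler_pM2l].
apply: le_trans (_ : (lam k `^ (2 * b)) ^+ 2 <= _); last by rewrite lerDr.
by rewrite ler_pXn2r// nnegrE powR_ge0.
Qed.

Lemma powA_norm a z : domP ip e lam a z ->
  \sum_(k < n) (lam k `^ (2 * a)) ^+ 2 * ip z (e k) ^+ 2 @[n --> \oo]
    --> `|powA ip e lam a z| ^+ 2.
Proof.
move=> hz; apply: eq_cvg_to (parseval_norm (powA ip e lam a z)) => n.
apply: eq_bigr => k _.
by rewrite powA_coef// exprMn.
Qed.

Lemma powR_quarter k : (lam k `^ (2 * (1 / 4))) ^+ 2 = lam k.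
Proof.
by rewrite -powR_mulrn ?powR_ge0// -powRrM (_ : _ * _ = 1) ?powRr1//; field.
Qed.

Lemma powR_half k : lam k `^ (2 * (1 / 2)) = lam k.
Proof. by rewrite (_ : _ * _ = 1) ?powRr1//; field. Qed.

(** Valid also where lam k = 0, since no exponent is 0. *)
Lemma powR_34 k : lam k `^ (2 * (3 / 4)) = lam k * lam k `^ (2 * (1 / 4)).
Proof.
have -> : (2 * (3 / 4) : R) = 2 * (1 / 2) + 2 * (1 / 4) by field.
rewrite powRD ?powR_half//.
by apply/implyP => /eqP h; exfalso; move: h; lra.
Qed.

Lemma powA_quarter_norm z : domP ip e lam (1 / 4) z ->
  \sum_(k < n) lam k * ip z (e k) ^+ 2 @[n --> \oo] --> `|powA ip e lam (1 / 4) z| ^+ 2.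
Proof.
move=> /powA_norm; under eq_fun do under eq_bigr do rewrite powR_quarter.
by apply.
Qed.

Lemma powA_half_norm z : domP ip e lam (1 / 2) z ->
  \sum_(k < n) lam k ^+ 2 * ip z (e k) ^+ 2 @[n --> \oo]
    --> `|powA ip e lam (1 / 2) z| ^+ 2.
Proof.
move=> /powA_norm; under eq_fun do under eq_bigr do rewrite powR_half.
by apply.
Qed.

Lemma powA_34_norm z : domP ip e lam (3 / 4) z ->
  \sum_(k < n) lam k ^+ 3 * ip z (e k) ^+ 2 @[n --> \oo]
    --> `|powA ip e lam (3 / 4) z| ^+ 2.
Proof.
move=> /powA_norm.
under eq_fun do under eq_bigr do rewrite powR_34 exprMn powR_quarter -exprSr.
by apply.
Qed.

Lemma domP_half_of_34 z : domP ip e lam (3 / 4) z -> domP ip e lam (1 / 2) z.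
Proof. by apply: domP_le; lra. Qed.

Lemma domP_quarter_of_34 z : domP ip e lam (3 / 4) z -> domP ip e lam (1 / 4) z.
Proof. by apply: domP_le; lra. Qed.

Definition state_energy z w : R :=
  `|w| ^+ 2 + `|powA ip e lam (1 / 4) w| ^+ 2
  + `|powA ip e lam (1 / 2) z| ^+ 2 + `|powA ip e lam (3 / 4) z| ^+ 2.

(** The energy is the limit of the nondecreasing partial energies of weight
    1 + lam, so that bounds on it and bounds on the modes are interchangeable. *)
Lemma state_energyP z w b : domP ip e lam (3 / 4) z -> domP ip e lam (1 / 4) w ->
  state_energy z w <= b <->
  energy_le lam (fun k => ip z (e k)) (fun k => ip w (e k)) b.
Proof.
move=> hz hw; have hz2 := domP_half_of_34 hz.
have lim : mode_energy lam (fun k => 1 + lam k) n (fun k => ip z (e k))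
    (fun k => ip w (e k)) @[n --> \oo] --> state_energy z w.
  have lim' : \sum_(k < n) ip w (e k) ^+ 2 + \sum_(k < n) lam k * ip w (e k) ^+ 2 +
     \sum_(k < n) lam k ^+ 2 * ip z (e k) ^+ 2 +
     \sum_(k < n) lam k ^+ 3 * ip z (e k) ^+ 2 @[n --> \oo] --> state_energy z w.
    exact: cvgD (cvgD (cvgD (parseval_norm w) (powA_quarter_norm hw))
      (powA_half_norm hz2)) (powA_34_norm hz).
  apply: eq_cvg_to lim' => n.
  by rewrite /= -!big_split/=; apply: eq_bigr => k _; ring.
split=> [zb n|zb].
  apply: le_trans zb; pose f k := (1 + lam k) * (ip w (e k) ^+ 2 + lam k ^+ 2 * ip z (e k) ^+ 2).
  apply: (@nondecreasing_sum_le f _ _ lim) => k.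
  rewrite mulr_ge0 ?addr_ge0// ?sqr_ge0// mulr_ge0// sqr_ge0//.
apply: (cvgr_to_le lim); apply: nearW => n; exact: zb.
Qed.

Lemma state_energy_ge0 z w : 0 <= state_energy z w.
Proof. by rewrite /state_energy !addr_ge0// sqr_ge0. Qed.

(** The square norm of A^(1/2) u is differentiated through this identity: u is
    differentiable in time only with values in D(A^(1/4)), and the missing quarter
    power is moved onto the factor z + w, which is merely continuous. *)
Lemma powA_half_sqrB z w : domP ip e lam (3 / 4) z -> domP ip e lam (3 / 4) w ->
  `|powA ip e lam (1 / 2) z| ^+ 2 - `|powA ip e lam (1 / 2) w| ^+ 2 =
  ip (powA ip e lam (1 / 4) (z - w)) (powA ip e lam (3 / 4) (z + w)).
Proof.
move=> hz hw.
have h1 : \sum_(k < n) lam k ^+ 2 * ip z (e k) ^+ 2 -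
   \sum_(k < n) lam k ^+ 2 * ip w (e k) ^+ 2 @[n --> \oo] -->
   `|powA ip e lam (1 / 2) z| ^+ 2 - `|powA ip e lam (1 / 2) w| ^+ 2.
  exact: cvgB (powA_half_norm (domP_half_of_34 hz)) (powA_half_norm (domP_half_of_34 hw)).
have h2 := parseval (powA ip e lam (1 / 4) (z - w)) (powA ip e lam (3 / 4) (z + w)).
suff h3 : \sum_(k < n) ip (powA ip e lam (1 / 4) (z - w)) (e k) *
    ip (powA ip e lam (3 / 4) (z + w)) (e k) @[n --> \oo] -->
    `|powA ip e lam (1 / 2) z| ^+ 2 - `|powA ip e lam (1 / 2) w| ^+ 2.
  exact: (cvg_unique _ h3 h2).
apply: eq_cvg_to h1 => n.
rewrite /= -sumrB; apply: eq_bigr => k _.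
rewrite !powA_coef; last 2 first.
- exact: domPD.
- by apply: domPB; exact: domP_quarter_of_34.
rewrite powR_34 ipBl ipDl.
transitivity (lam k * (lam k `^ (2 * (1 / 4))) ^+ 2 * (ip z (e k) ^+ 2 - ip w (e k) ^+ 2)).
  by rewrite powR_quarter; ring.
by ring.
Qed.

Lemma powA_half_le z : domP ip e lam (3 / 4) z ->
  `|powA ip e lam (1 / 2) z| ^+ 2 <= `|z| ^+ 2 + `|powA ip e lam (3 / 4) z| ^+ 2.
Proof.
move=> hz.
have lim : \sum_(k < n) ip z (e k) ^+ 2 + \sum_(k < n) lam k ^+ 3 * ip z (e k) ^+ 2
    @[n --> \oo] --> `|z| ^+ 2 + `|powA ip e lam (3 / 4) z| ^+ 2.
  exact: cvgD (parseval_norm z) (powA_34_norm hz).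
apply: ler_cvg_to (powA_half_norm (domP_half_of_34 hz)) lim _.
apply: nearW => n; rewrite -big_split/=; apply: ler_sum => k _.
have h : lam k ^+ 2 <= 1 + lam k ^+ 3.
  have l0 := lam0 k; case: (lerP (lam k) 1) => lk.
    have := exprn_ge0 3 l0; have : lam k ^+ 2 <= 1 by rewrite expr_le1.
    lra.
  by apply: le_trans (_ : lam k ^+ 3 <= _); [rewrite ler_weXn2l// ltW|rewrite lerDr].
by have := ler_wpM2r (sqr_ge0 (ip z (e k))) h; rewrite mulrDl mul1r.
Qed.

Lemma regular_data_bounded z w : domP ip e lam (5 / 4) z -> domP ip e lam (3 / 4) w ->
  exists Z, forall n, mode_energy lam (fun k => lam k ^+ 3) n
    (fun k => ip z (e k)) (fun k => ip w (e k)) <= Z.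
Proof.
move=> /domP_bounded[B zB] /domP_bounded[C wC]; exists (C + B) => n.
apply: le_trans (lerD (wC n) (zB n)); rewrite -big_split/=; apply: ler_sum => k _.
rewrite !exprMn powR_34 exprMn powR_quarter.
have -> : (2 * (5 / 4) : R) = 2 * (1 / 2) + 2 * (3 / 4) by field.
rewrite powRD; last by apply/implyP => /eqP h; exfalso; move: h; lra.
by rewrite powR_half powR_34 !exprMn powR_quarter le_eqVlt; apply/orP; left; apply/eqP; ring.
Qed.

Lemma state_energy_le_graph z w : domP ip e lam (3 / 4) z ->
  state_energy z w <= graph_norm ip e lam (1 / 4) w ^+ 2
                      + 2 * graph_norm ip e lam (3 / 4) z ^+ 2.
Proof.
move=> hz; have := powA_half_le hz.
rewrite /state_energy /graph_norm !sqr_sqrtr ?addr_ge0 ?sqr_ge0//.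
have := sqr_ge0 `|z|; lra.
Qed.

Lemma norm_le_graph a z : `|z| <= graph_norm ip e lam a z.
Proof.
by rewrite -[leLHS]ger0_norm// -sqrtr_sqr ler_wsqrtr// lerDl sqr_ge0.
Qed.

Lemma powA_norm_le_graph a z : `|powA ip e lam a z| <= graph_norm ip e lam a z.
Proof.
by rewrite -[leLHS]ger0_norm// -sqrtr_sqr ler_wsqrtr// lerDr sqr_ge0.
Qed.

Section convergence.
Context {F : set_system R} {FF : Filter F}.

Lemma cvg_domP_norm a f z : cvg_domP ip e lam a F f z -> f @ F --> z.
Proof.
move=> [_ _ /cvgrPdist_lt fz]; apply/cvgrPdist_lt => eps eps0.
move: (fz eps eps0); apply: filterS => s; rewrite sub0r normrN => h.
rewrite distrC; apply: le_lt_trans h; apply: le_trans (norm_le_graph a _) _.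
exact: ler_norm.
Qed.

Lemma cvg_domP_powA a f z : cvg_domP ip e lam a F f z ->
  powA ip e lam a (f s) @[s --> F] --> powA ip e lam a z.
Proof.
move=> [hz hf /cvgrPdist_lt fz]; apply/cvgrPdist_lt => eps eps0.
move: hf (fz eps eps0); apply: filterS2 => s hfs; rewrite sub0r normrN => h.
rewrite distrC -powAB//; apply: le_lt_trans h.
by apply: le_trans (powA_norm_le_graph a _) _; exact: ler_norm.
Qed.

Lemma cvg_domP_powA_half f z : cvg_domP ip e lam (3 / 4) F f z ->
  powA ip e lam (1 / 2) (f s) @[s --> F] --> powA ip e lam (1 / 2) z.
Proof.
move=> [hz hf /cvgrPdist_lt fz]; apply/cvgrPdist_lt => eps eps0.
move: hf (fz eps eps0); apply: filterS2 => s hfs; rewrite sub0r normrN => h.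
rewrite distrC -powAB; [|exact: domP_half_of_34|exact: domP_half_of_34].
apply: le_lt_trans h; apply: le_trans (ler_norm _).
rewrite -[leLHS]ger0_norm// -sqrtr_sqr ler_wsqrtr//.
by apply: powA_half_le; exact: domPB.
Qed.

Lemma state_energy_cvg f g z w :
  cvg_domP ip e lam (3 / 4) F f z -> cvg_domP ip e lam (1 / 4) F g w ->
  state_energy (f s) (g s) @[s --> F] --> state_energy z w.
Proof.
move=> fz gw.
have sq (h : R -> H) x : h @ F --> x -> `|h s| ^+ 2 @[s --> F] --> `|x| ^+ 2.
  by move=> hx; apply: cvgM; exact: cvg_norm.
apply: cvgD; last by apply: sq; exact: cvg_domP_powA.
apply: cvgD; last by apply: sq; exact: cvg_domP_powA_half.
apply: cvgD; last by apply: sq; exact: cvg_domP_powA.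
by apply: sq; exact: cvg_domP_norm gw.
Qed.

Lemma graph_norm_triangle a z w : domP ip e lam a z -> domP ip e lam a w ->
  graph_norm ip e lam a (z - w) ^+ 2 <=
  2 * (graph_norm ip e lam a z ^+ 2 + graph_norm ip e lam a w ^+ 2).
Proof.
move=> hz hw; rewrite /graph_norm !sqr_sqrtr ?addr_ge0 ?sqr_ge0// powAB//.
have par x y : `|x - y| ^+ 2 <= 2 * (`|x| ^+ 2 + `|y| ^+ 2).
  by have := ip_double_le x y; rewrite ler_norml sqnormB => /andP[]; lra.
have := par z w; have := par (powA ip e lam a z) (powA ip e lam a w); lra.
Qed.

Lemma cvg_domPB a f g z w :
  cvg_domP ip e lam a F f z -> cvg_domP ip e lam a F g w ->
  cvg_domP ip e lam a F (fun s => f s - g s) (z - w).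
Proof.
move=> [hz hf fz] [hw hg gw]; split; first exact: domPB.
  by move: hf hg; apply: filterS2 => s; exact: domPB.
have lim : 2 * (graph_norm ip e lam a (f s - z) ^+ 2
    + graph_norm ip e lam a (g s - w) ^+ 2) @[s --> F] --> (0 : R).
  rewrite (_ : 0 = 2 * (0 ^+ 2 + 0 ^+ 2) :> R); last by rewrite expr0n/= addr0 mulr0.
  by apply: cvgMr; apply: cvgD; apply: cvgM.
apply/cvgr0Pnorm_lt => eps eps0.
have /cvgr0Pnorm_lt/(_ (eps ^+ 2)) := lim.
rewrite exprn_gt0// => /(_ isT) lim'.
move: hf hg lim'; apply: filterS3 => s hfs hgs.
have g0 x : 0 <= graph_norm ip e lam a x by exact: sqrtr_ge0.
rewrite !ger0_norm ?mulr_ge0 ?addr_ge0 ?sqr_ge0// => h.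
rewrite -(@ltr_pXn2r _ 2) ?nnegrE ?(ltW eps0)//; apply: le_lt_trans h.
rewrite (_ : f s - g s - (z - w) = f s - z - (g s - w)); last first.
  by rewrite !opprD !opprK addrACA.
by apply: graph_norm_triangle; exact: domPB.
Qed.

End convergence.

End hilbert.

(** * Time derivatives and modes of a solution *)

Section interval_derivative.
Context {R : realType} {V : normedModType R}.
Implicit Types (f g : R -> V) (I : set R).

Lemma within_itv_proper (S t : R) : 0 < S -> 0 <= t <= S ->
  ProperFilter (within `[0, S] t^').
Proof.
move=> S0 /andP[t0 tS]; apply: Build_ProperFilter_ex => A.
rewrite /within/= => /nbhs_ballP[d d0 dA].
have [t1|t1] := leP t (S / 2).
  exists (t + Num.min (d / 2) (S / 2)).
  have mp : 0 < Num.min (d / 2) (S / 2) by rewrite lt_min !divr_gt0.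
  apply: dA.
  - rewrite /ball/= opprD addrA subrr sub0r normrN gtr0_norm//.
    by rewrite gt_min [X in X || _]ltr_pdivrMr// ltr_pMr// ltr1n.
  - by rewrite -subr_eq0 addrAC subrr add0r gt_eqF.
  rewrite /= in_itv/= addr_ge0 ?(ltW mp)//=.
  by rewrite [leRHS](splitr S) lerD// ge_min lexx orbT.
exists (t - Num.min (d / 2) (S / 2)).
have mp : 0 < Num.min (d / 2) (S / 2) by rewrite lt_min !divr_gt0.
apply: dA.
- rewrite /ball/= opprB addrC subrK gtr0_norm//.
  by rewrite gt_min [X in X || _]ltr_pdivrMr// ltr_pMr// ltr1n.
- by rewrite -subr_eq0 addrAC subrr add0r oppr_eq0 gt_eqF.
rewrite /= in_itv/= subr_ge0 ge_min (ltW t1) orbT/=.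
by rewrite lerBlDr (le_trans tS)// lerDl ltW.
Qed.

(** The three derivatives are taken relative to three intervals: at the right end
    of [0, S] the first is one-sided, the other two need not be. They fit together
    because a limit along I is also a limit along [0, S], where it is unique. *)
Lemma deriv_on_sub I I' (S : R) f g (t : R) : 0 < S -> 0 <= t <= S ->
  `[0, S] `<=` I -> `[0, S] `<=` I' ->
  diff_quot f t s @[s --> within I t^'] --> deriv_on I f t ->
  diff_quot g t s @[s --> within I' t^'] --> deriv_on I' g t ->
  deriv_on `[0, S] (fun s => f s - g s) t = deriv_on I f t - deriv_on I' g t.
Proof.
move=> S0 tS SI SI' fI gI; have PF := within_itv_proper S0 tS.
apply: cvg_lim => //.
have restrict h l I0 : `[0, S] `<=` I0 -> h s @[s --> within I0 t^'] --> l ->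
    h s @[s --> within `[0, S] t^'] --> (l : V).
  move=> SI0 /cvg_within_dnbhsP hl; apply/cvg_within_dnbhsP => eps eps0.
  have [d d0 dP] := hl eps eps0; exists d => // s sd st sS.
  by apply: dP => //; exact: SI0.
apply: eq_cvg_to (cvgB (restrict _ _ _ SI fI) (restrict _ _ _ SI' gI)) => s.
rewrite /diff_quot/= -[LHS]/(_ *: _ - _ *: _) -scalerBr; congr (_ *: _).
by rewrite !opprD !opprK addrACA.
Qed.

End interval_derivative.

Section evolution.
Context {R : realType} {H : completeNormedModType R}.
Variables (ip : {dot H for idfun}) (e : nat -> H) (lam : nat -> R) (m : R -> R).
Hypothesis nrm : norm_from_dot ip.
Hypothesis onb : orthonormal_basis ip e.
Hypothesis lam0 : forall k, 0 <= lam k.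
Implicit Types (I J : set R) (u : R -> H).

Lemma itv_interior (S t : R) : 0 < t < S ->
  exists2 r : R, 0 < r & forall s, `|s - t| < r -> `[0, S]%classic s.
Proof.
move=> /andP[t0 tS]; exists (Num.min t (S - t)); first by rewrite lt_min t0 subr_gt0.
move=> s; rewrite lt_min => /andP[h1 h2].
move: h1 h2; rewrite !ltr_norml => /andP[h1 _] /andP[_ h2].
rewrite /= in_itv/=; apply/andP; split; lra.
Qed.

Section one_solution.
Variables (I : set R) (u0 u1 : H) (u : R -> H).
Hypothesis sol : solution ip e lam m I u0 u1 u.
Let v := deriv_on I u.

Lemma solution_dom t : I t -> domP ip e lam (3 / 4) (u t) /\ domP ip e lam (1 / 4) (v t).
Proof.
move=> It; have [c0 [_ _ c1] _ _ _] := sol.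
by split; [have [] := c0 t It|have [] := c1 t It].
Qed.

Lemma solution_velocity t : I t -> diff_quot u t s @[s --> within I t^'] --> v t.
Proof.
move=> It; have [_ [_ c1 _] _ _ _] := sol.
exact: (cvg_domP_norm (c1 t It)).
Qed.

Lemma solution_state_energy_continuous t : I t ->
  state_energy ip e lam (u s) (v s) @[s --> within I (nbhs t)] -->
  state_energy ip e lam (u t) (v t).
Proof.
move=> It; have [c0 [_ _ c1] _ _ _] := sol.
by apply: state_energy_cvg => //; [exact: c0|exact: c1].
Qed.

(** Testing the equation with an eigenvector gives the second order equation of a
    mode. *)
Lemma solution_modal (S : R) : `[0, S] `<=` I ->
  modal_solution m lam S (fun k t => ip (u t) (e k)) (fun k t => ip (v t) (e k))
    (fun t => `|powA ip e lam (1 / 2) (u t)| ^+ 2)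
    (fun t => 2 * ip (powA ip e lam (1 / 4) (v t)) (powA ip e lam (3 / 4) (u t))).
Proof.
move=> SI; have [c0 [c0' dq c1] ode _ _] := sol.
have inI t : 0 < t < S -> I t.
  by move=> /andP[t0 tS]; apply: SI; rewrite /= in_itv/= !ltW.
have interior t (g : R -> R) (l : R) : 0 < t < S ->
    g s @[s --> within I t^'] --> l -> g s @[s --> t^'] --> l.
  move=> tS gl; have [r r0 rP] := itv_interior tS.
  have rI s : `|s - t| < r -> I s by move=> /rP; exact: SI.
  exact: (cvg_within_interior r0 rI gl).
have contI (g : R -> R) :
    (forall t, I t -> g s @[s --> within I (nbhs t)] --> g t) ->
    {within `[0, S], continuous g}.
  by move=> gI; apply: continuous_subspaceW SI _; exact/subspace_continuousP.
split.
- move=> k t tS; apply: diff_quot_is_derive; apply: (interior t _ _ tS).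
  apply: eq_cvg_to (ip_cvg nrm (solution_velocity (inI t tS)) (cvg_cst (e k))) => s.
  by rewrite /diff_quot ipZl ipBl.
- move=> k t tS; apply: diff_quot_is_derive; apply: (interior t _ _ tS).
  have [hz hw] := solution_dom (inI t tS).
  have := ode t (inI t tS) (e k) (domP_basis lam onb (1 / 4) k).
  rewrite (_ : ip (powA ip e lam (3 / 4) (u t)) _ = lam k ^+ 2 * ip (u t) (e k))//.
  have -> : powA ip e lam (1 / 4) (e k) = lam k `^ (2 * (1 / 4)) *: e k.
    apply: (coef_ext onb) => j; rewrite powA_coef//; last exact: domP_basis.
    rewrite ipZl onb.1; case: eqP => [->//|_]; by rewrite !mulr0.
  rewrite ipC ipZl ipC powA_coef// powR_34//.
  transitivity (lam k * (lam k `^ (2 * (1 / 4))) ^+ 2 * ip (u t) (e k)); first by ring.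
  by rewrite powR_quarter// expr2.
- move=> t tS; apply: diff_quot_is_derive; apply: (interior t _ _ tS).
  have It := inI t tS; have [hz hw] := solution_dom It.
  have lim1 : powA ip e lam (1 / 4) (diff_quot u t s) @[s --> within I t^'] -->
      powA ip e lam (1 / 4) (v t) by have := cvg_domP_powA nrm onb (dq t It); apply.
  have lim2 : powA ip e lam (3 / 4) (u s) + powA ip e lam (3 / 4) (u t)
      @[s --> within I t^'] --> powA ip e lam (3 / 4) (u t) + powA ip e lam (3 / 4) (u t).
    apply: cvgD; last exact: cvg_cst.
    exact: cvg_within_dnbhs (cvg_domP_powA nrm onb (c0 t It)).
  have lim3 : ip (powA ip e lam (1 / 4) (diff_quot u t s))
      (powA ip e lam (3 / 4) (u s) + powA ip e lam (3 / 4) (u t))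
      @[s --> within I t^'] --> ip (powA ip e lam (1 / 4) (v t))
        (powA ip e lam (3 / 4) (u t) + powA ip e lam (3 / 4) (u t)).
    by have := ip_cvg nrm lim1 lim2; apply.
  rewrite (_ : 2 * _ = ip (powA ip e lam (1 / 4) (v t))
    (powA ip e lam (3 / 4) (u t) + powA ip e lam (3 / 4) (u t))); last first.
    by rewrite [RHS]ipC ipDl (ipC ip (powA ip e lam (3 / 4) (u t))); ring.
  apply: (@eq_cvg_within R R I _ _ t _ _ lim3) => s Is st.
  have [hs _] := solution_dom Is.
  rewrite /diff_quot powA_half_sqrB// -powAD// powAZ// ?ipZl//.
  by apply: domPB => //; apply: domP_quarter_of_34.
- move=> k; apply: contI => t It.
  by apply: ip_cvg => //; [exact: cvg_domP_norm (c0 t It)|exact: cvg_cst].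
- move=> k; apply: contI => t It.
  by apply: ip_cvg => //; [exact: cvg_domP_norm (c1 t It)|exact: cvg_cst].
- apply: contI => t It.
  by apply: cvgM; apply: cvg_norm; exact: cvg_domP_powA_half (c0 t It).
- by move=> t; exact: sqr_ge0.
- move=> t tS; have It : I t by apply: SI; rewrite /= in_itv.
  by apply: powA_half_norm => //; apply: domP_half_of_34 => //; have [] := solution_dom It.
- move=> t b tS; have [hz hw] := solution_dom (inI t tS).
  move=> /(state_energyP nrm onb lam0 b hz hw); apply: le_trans.
  apply: le_trans (ip_double_le nrm _ _) _; rewrite /state_energy.
  have := sqr_ge0 `|v t|; have := sqr_ge0 `|powA ip e lam (1 / 2) (u t)|; lra.
Qed.

End one_solution.

End evolution.

(** * Perturbations on a compact time interval *)

(** At the infimum tau of the times where f > 1 / 2, continuity gives f <= 3 / 4,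
    and f <= 1 on a slightly longer interval; there the self-improving bound
    forces f <= 1 / 2 again. *)
Lemma continuity_method {R : realType} (f : R -> R) (S : R) :
  {within `[0, S], continuous f} -> f 0 <= 1 / 2 ->
  (forall s, 0 < s <= S -> (forall t, 0 <= t <= s -> f t <= 1) -> f s <= 1 / 2) ->
  forall t, 0 <= t <= S -> f t <= 1 / 2.
Proof.
move=> /within_continuousP fc f0 step t1 t1S; rewrite leNgt; apply/negP => ft1.
pose A := [set t | 0 <= t <= S /\ 1 / 2 < f t].
have infA : has_inf A.
  by split; [exists t1|exists 0 => t [/andP[]]].
pose tau := inf A.
have tau0 : 0 <= tau by apply: lb_le_inf; [exists t1|move=> t [/andP[]]].
have tauS : tau <= S.
  apply: le_trans (_ : t1 <= _); last by case/andP: t1S.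
  by apply: (ge_inf infA.2).
have below t : 0 <= t < tau -> f t <= 1 / 2.
  move=> /andP[t0 ttau]; rewrite leNgt; apply/negP => ft.
  have : tau <= t by apply: (ge_inf infA.2); split=> //; rewrite t0 (le_trans (ltW ttau)).
  by rewrite leNgt ttau.
have tauI : `[0, S]%classic tau by rewrite /= in_itv/= tau0.
have q0 : (0 : R) < 1 / 4 by rewrite divr_gt0.
have [d d0 dP] := fc tau tauI _ q0.
have ftau : f tau <= 3 / 4.
  move: tau0; rewrite le_eqVlt => /predU1P[<-|tau0]; first by lra.
  pose s := Num.max 0 (tau - d / 2).
  have s0 : 0 <= s by rewrite le_max lexx.
  have st : s < tau by rewrite gt_max tau0/= ltrBlDr ltrDl divr_gt0.
  have sd : `|s - tau| < d.
    rewrite distrC gtr0_norm ?subr_gt0// ltrBlDr -ltrBlDl lt_max.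
    by apply/orP; right; lra.
  have := dP s sd; rewrite /= in_itv/= s0 (le_trans (ltW st))// => /(_ isT).
  have : f s <= 1 / 2 by apply: below; rewrite s0.
  by rewrite ltr_norml => ? /andP[]; lra.
have [t [/andP[t0 tS] ft] ttau] := inf_adherent d0 infA.
have : f t <= 1 / 2.
  apply: step.
    rewrite tS andbT lt_neqAle t0 andbT; apply: contraTneq ft => <-.
    by rewrite -leNgt.
  move=> s /andP[s0 st]; have [stau|taus] := ltP s tau.
    by apply: le_trans (below s _) _; [rewrite s0|lra].
  have sd : `|s - tau| < d.
    by rewrite ger0_norm ?subr_ge0// ltrBlDl; apply: le_lt_trans st _.
  have := dP s sd; rewrite /= in_itv/= s0 (le_trans st tS) => /(_ isT).
  by rewrite ltr_norml => /andP[]; lra.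
by rewrite leNgt ft.
Qed.

Section perturbation.
Context {R : realType} {H : completeNormedModType R}.
Variables (ip : {dot H for idfun}) (e : nat -> H) (lam : nat -> R) (m : R -> R) (nu0 : R).
Hypothesis nrm : norm_from_dot ip.
Hypothesis onb : orthonormal_basis ip e.
Hypothesis lam0 : forall k, 0 <= lam k.
Hypothesis C1m : C1_on `[0, +oo[ m.
Hypothesis nu0_gt0 : 0 < nu0.
Hypothesis m_ge : forall sigma, 0 <= sigma -> nu0 <= m sigma.

Local Notation En := (state_energy ip e lam).

Lemma state_energyB_le z w z' w' :
  domP ip e lam (3 / 4) z -> domP ip e lam (1 / 4) w ->
  domP ip e lam (3 / 4) z' -> domP ip e lam (1 / 4) w' ->
  En z w <= 2 * (En (z - z') (w - w') + En z' w').
Proof.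
move=> hz hw hz' hw'.
have par (x y : H) : `|x| ^+ 2 <= 2 * (`|x - y| ^+ 2 + `|y| ^+ 2).
  have := ip_double_le nrm (x - y) y; have := sqnormD nrm (x - y) y.
  rewrite subrK => ->; rewrite ler_norml => /andP[]; lra.
rewrite /state_energy !powAB//; try exact: domP_half_of_34.
have h1 := par w w'; have h2 := par (powA ip e lam (1 / 4) w) (powA ip e lam (1 / 4) w').
have h3 := par (powA ip e lam (1 / 2) z) (powA ip e lam (1 / 2) z').
have h4 := par (powA ip e lam (3 / 4) z) (powA ip e lam (3 / 4) z').
lra.
Qed.

Variables (J : set R) (u0 u1 : H) (u : R -> H) (T : R).
Hypothesis solu : solution ip e lam m J u0 u1 u.
Hypothesis T0 : 0 < T.
Hypothesis TJ : `[0, T] `<=` J.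
Local Notation u' := (deriv_on J u).

Lemma energy_bounded : exists2 M, 0 <= M & forall t, 0 <= t <= T -> En (u t) (u' t) <= M.
Proof.
have cE : {within `[0, T], continuous (fun t => En (u t) (u' t))}.
  apply: continuous_subspaceW TJ _; apply/subspace_continuousP => t Jt.
  exact: solution_state_energy_continuous solu _ Jt.
have [c _ cP] := EVT_max (ltW T0) cE.
exists (En (u c) (u' c)); first exact: state_energy_ge0.
by move=> t tT; apply: cP; rewrite in_itvcc.
Qed.

Definition gap I (w : R -> H) t := En (w t - u t) (deriv_on I w t - u' t).

Section one_perturbation.
Variables (I : set R) (w0 w1 : H) (w : R -> H) (S : R).
Hypothesis solw : solution ip e lam m I w0 w1 w.
Hypothesis SI : `[0, S] `<=` I.
Hypothesis ST : S <= T.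

Let inI t : 0 <= t <= S -> I t.
Proof. by move=> tS; apply: SI; rewrite /= in_itv. Qed.

Let inJ t : 0 <= t <= S -> J t.
Proof.
by move=> /andP[t0 tS]; apply: TJ; rewrite /= in_itv/= t0 (le_trans tS).
Qed.

Lemma gap_continuous : {within `[0, S], continuous (gap I w)}.
Proof.
have [cu [_ _ cu'] _ _ _] := solu; have [cw [_ _ cw'] _ _ _] := solw.
have restrict a I0 f l (t : R) : `[0, S] `<=` I0 ->
    cvg_domP ip e lam a (within I0 (nbhs t)) f l ->
    cvg_domP ip e lam a (within `[0, S] (nbhs t)) f l.
  move=> SI0 [hl hf fl].
  have mono (P : set R) : within I0 (nbhs t) P -> within `[0, S] (nbhs t) P.
    move=> h; have h' : nbhs t (fun s => I0 s -> P s) := h.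
    suff : nbhs t (fun s => `[0, S]%classic s -> P s) by apply.
    by apply: filterS h' => s h' sS; apply: h'; exact: SI0.
  split=> //.
    exact: mono hf.
  by move=> A A0; apply: mono; exact: fl.
have SJ : `[0, S] `<=` J by move=> t; rewrite /= in_itv/=; exact: inJ.
apply/subspace_continuousP => t tS.
apply: state_energy_cvg => //; apply: cvg_domPB => //.
- by apply: (restrict _ _ _ _ _ SI); apply: cw; exact: SI.
- by apply: (restrict _ _ _ _ _ SJ); apply: cu; exact: SJ.
- by apply: (restrict _ _ _ _ _ SI); apply: cw'; exact: SI.
- by apply: (restrict _ _ _ _ _ SJ); apply: cu'; exact: SJ.
Qed.

Lemma gapP t b : 0 <= t <= S -> gap I w t <= b <->
  energy_le lam (fun k => ip (w t) (e k) - ip (u t) (e k))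
    (fun k => ip (deriv_on I w t) (e k) - ip (u' t) (e k)) b.
Proof.
move=> tS; have [hw hw'] := solution_dom solw (inI tS).
have [hu hu'] := solution_dom solu (inJ tS).
rewrite /gap state_energyP//; [|exact: domPB|exact: domPB].
have B (x y : H) : (fun k => ip (x - y) (e k)) = (fun k => ip x (e k) - ip y (e k)).
  by apply/funext => k; rewrite ipBl.
by rewrite !B.
Qed.

Lemma perturbed_energy_le t M : 0 <= t <= S -> En (u t) (u' t) <= M ->
  gap I w t <= 1 -> En (w t) (deriv_on I w t) <= 2 * (1 + M).
Proof.
move=> tS uM gap1; have [hw hw'] := solution_dom solw (inI tS).
have [hu hu'] := solution_dom solu (inJ tS).
apply: le_trans (state_energyB_le hw hw' hu hu') _.
by apply: ler_wpM2l => //; apply: lerD.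
Qed.

Lemma energy_gap t : 0 < S -> 0 <= t <= S ->
  energy ip e lam `[0, S] (fun s => w s - u s) t = gap I w t.
Proof.
move=> S0 tS; rewrite /energy /gap.
rewrite (deriv_on_sub S0 tS (f := w) (g := u) SI _ (solution_velocity solw (inI tS))
  (solution_velocity solu (inJ tS)))//.
Qed.

End one_perturbation.

(** The constants in the estimate of the difference depend on the energies of both
    solutions, and nothing is known beforehand about the energy of w. While the
    gap stays below 1, however, that energy is at most 2 (1 + M), and the estimate
    returns a gap below 1 / 2: the continuity method applies, with a delta that
    depends neither on w nor on the length of its interval. *)
Lemma gap_small eta : 0 < eta -> exists2 delta, 0 < delta &
  forall I w0 w1 w S, solution ip e lam m I w0 w1 w -> 0 < S <= T ->
  `[0, S] `<=` I -> En (w0 - u0) (w1 - u1) <= delta ->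
  forall t, 0 <= t <= S -> gap I w t <= Num.min eta (1 / 2).
Proof.
move=> eta0; have [M M0 enu] := energy_bounded.
pose M' := 2 * (1 + M).
have M'0 : 0 <= M' by rewrite /M'; lra.
have MM' : M <= M' by rewrite /M'; lra.
pose eta' := Num.min eta (1 / 2).
have eta'0 : 0 < eta' by rewrite lt_min eta0 divr_gt0.
have J0 : J 0 by apply: TJ; rewrite /= in_itv/= lexx ltW.
have [hu0 hu0'] := solution_dom solu J0.
have T00 : (0 : R) <= 0 <= T by rewrite lexx ltW.
have en0 : energy_le lam (fun k => ip (u 0) (e k)) (fun k => ip (u' 0) (e k)) M'.
  by apply/(state_energyP nrm onb lam0) => //; apply: le_trans MM'; exact: enu.
have [d d0 stable] := modes_stable lam0 C1m nu0_gt0 m_ge T M'0 eta'0 en0.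
exists (Num.min d (1 / 2)); first by rewrite lt_min d0 divr_gt0.
move=> I w0 w1 w S solw /andP[S0 ST] SI; rewrite le_min => /andP[dle dle2].
have inS t s : 0 <= t <= s -> s <= S -> 0 <= t <= S.
  by move=> /andP[t0 ts] sS; rewrite t0 (le_trans ts).
have [_ _ _ w0E w1E] := solw; have [_ _ _ u0E u1E] := solu.
have S00 : (0 : R) <= 0 <= S by rewrite lexx ltW.
have gap0 : gap I w 0 = En (w0 - u0) (w1 - u1) by rewrite /gap w0E w1E u0E u1E.
(* The estimate under the provisional assumption that the gap is at most 1. *)
have conf s : 0 < s <= S -> (forall t, 0 <= t <= s -> gap I w t <= 1) ->
    forall t, 0 <= t <= s -> gap I w t <= eta'.
  move=> /andP[s0 sS] gap1 t ts.
  have sI : `[0, s] `<=` I.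
    by move=> x; rewrite /= in_itv/= => xs; apply: SI; rewrite /= in_itv/=; exact: inS xs sS.
  have sJ : `[0, s] `<=` J.
    move=> x; rewrite /= in_itv/= => xs; apply: TJ; rewrite /= in_itv/=.
    by have /andP[-> xS] := inS _ _ xs sS; rewrite (le_trans xS).
  have sT : s <= T by exact: le_trans ST.
  apply/(gapP solw sI sT) => //.
  apply: (stable s _ _ _ _ _ _ _ _ sT (solution_modal nrm onb lam0 solu sJ)
    (solution_modal nrm onb lam0 solw sI)) => //.
  - move=> x xs; have xT : 0 <= x <= T by case/andP: xs => -> /le_trans; apply.
    have Jx : J x by apply: sJ; rewrite /= in_itv.
    have [hz hz'] := solution_dom solu Jx.
    by apply/(state_energyP nrm onb lam0) => //; apply: le_trans MM'; exact: enu.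
  - move=> x xs; have xT : 0 <= x <= T by case/andP: xs => -> /le_trans; apply.
    have Ix : I x by apply: sI; rewrite /= in_itv.
    have [hz hz'] := solution_dom solw Ix.
    apply/(state_energyP nrm onb lam0) => //.
    by apply: (perturbed_energy_le solw sI sT) => //; [exact: enu|exact: gap1].
  - by apply/(gapP solw sI sT); [rewrite lexx ltW|rewrite gap0].
have half t : 0 <= t <= S -> gap I w t <= 1 / 2.
  apply: (continuity_method (gap_continuous solw SI ST)); first by rewrite gap0.
  move=> s sS gap1; apply: le_trans (conf s sS gap1 s _) _.
    by case/andP: sS => /ltW ->; rewrite lexx.
  by rewrite ge_min lexx orbT.
apply: (conf S); first by rewrite S0/=.
by move=> t tS; apply: le_trans (half t tS) _; lra.
Qed.

Lemma gap_lipschitz : domP ip e lam (5 / 4) u0 -> domP ip e lam (3 / 4) u1 ->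
  exists G : R,
  forall I w0 w1 w, solution ip e lam m I w0 w1 w -> `[0, T] `<=` I ->
  (forall t, 0 <= t <= T -> gap I w t <= 1) ->
  forall t, 0 <= t <= T -> gap I w t <= G * gap I w 0.
Proof.
move=> reg0 reg1; have [M M0 enu] := energy_bounded.
pose M' := 2 * (1 + M).
have M'0 : 0 <= M' by rewrite /M'; lra.
have MM' : M <= M' by rewrite /M'; lra.
have [_ _ _ u0E u1E] := solu.
have [Z ZP] := regular_data_bounded lam0 reg0 reg1.
have [G G0 GP] := regular_modes_lipschitz lam0 C1m nu0_gt0 m_ge T M'0 ZP.
exists G => I w0 w1 w solw TI gap1 t tT.
have TT : T <= T by [].
apply/(gapP solw TI TT) => //.
apply: (GP T _ _ _ _ _ _ _ _ TT (solution_modal nrm onb lam0 solu TJ)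
    (solution_modal nrm onb lam0 solw TI)) => //.
- by move=> k; rewrite u0E.
- by move=> k; rewrite u1E.
- move=> x xT; have Jx : J x by apply: TJ; rewrite /= in_itv.
  have [hz hz'] := solution_dom solu Jx.
  by apply/(state_energyP nrm onb lam0) => //; apply: le_trans MM'; exact: enu.
- move=> x xT; have Ix : I x by apply: TI; rewrite /= in_itv.
  have [hz hz'] := solution_dom solw Ix.
  apply/(state_energyP nrm onb lam0) => //.
  by apply: (perturbed_energy_le solw TI TT) => //; [exact: enu|exact: gap1].
- by apply/(gapP solw TI TT); rewrite ?lexx ?ltW.
Qed.

End perturbation.

(** * Life spans and the main theorem *)

Section maximal_perturbation.
Context {R : realType} {H : completeNormedModType R}.
Variables (ip : {dot H for idfun}) (e : nat -> H) (lam : nat -> R) (m : R -> R) (nu0 : R).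
Hypothesis nrm : norm_from_dot ip.
Hypothesis onb : orthonormal_basis ip e.
Hypothesis lam0 : forall k, 0 <= lam k.
Hypothesis C1m : C1_on `[0, +oo[ m.
Hypothesis nu0_gt0 : 0 < nu0.
Hypothesis m_ge : forall sigma, 0 <= sigma -> nu0 <= m sigma.

Local Notation En := (state_energy ip e lam).
Local Notation LS := (life_span ip e lam m).

Lemma life_interval_sub (L : \bar R) (T : R) : (T%:E < L)%E ->
  `[0, T] `<=` [set t : R | 0 <= t /\ (t%:E < L)%E].
Proof.
move=> TL t; rewrite /= in_itv/= => /andP[t0 tT]; split=> //.
by apply: le_lt_trans TL; rewrite lee_fin.
Qed.

Lemma limf_esup_left_le (f : R -> \bar R) (T : R) (C : R) : 0 < T ->
  (forall t, 0 <= t < T -> (f t <= C%:E)%E) -> (limf_esup f T^'- <= C%:E)%E.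
Proof.
move=> T0 fC; pose V := [set t | 0 <= t < T].
have FV : T^'- V.
  apply/nbhs_ballP; exists T => //= t; rewrite /ball/= => tT tT'.
  rewrite /V/= tT' andbT; move: tT; rewrite gtr0_norm ?subr_gt0//; lra.
apply: ge_ereal_inf; exists (ereal_sup (f @` V)); first by exists V.
by apply: ge_ereal_sup => _ [t tV <-]; exact: fC.
Qed.

Variables (u0 u1 : H) (u : R -> H) (T : R).
Hypothesis maxu : maximal_solution ip e lam m u0 u1 u.
Hypothesis T0 : 0 < T.
Hypothesis TL : (T%:E < LS u0 u1)%E.
Local Notation J := [set t : R | 0 <= t /\ (t%:E < LS u0 u1)%E].

(** If the perturbed solution ended at some Tw <= T, its energy would remain below
    2 (1 + M) up to Tw, against the blow-up alternative. *)
Lemma maximal_gap_small eta : 0 < eta -> exists2 delta, 0 < delta &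
  forall w0 w1 w, maximal_solution ip e lam m w0 w1 w ->
  En (w0 - u0) (w1 - u1) <= delta ->
  (T%:E < LS w0 w1)%E /\
  forall t, 0 <= t <= T ->
    gap ip e lam J u [set t : R | 0 <= t /\ (t%:E < LS w0 w1)%E] w t <= Num.min eta (1 / 2).
Proof.
move=> eta0; have [L0 solu _] := maxu.
have TJ : `[0, T] `<=` J by exact: life_interval_sub.
have [M M0 enu] := energy_bounded nrm onb lam0 solu T0 TJ.
have [d d0 small] := gap_small nrm onb lam0 C1m nu0_gt0 m_ge solu T0 TJ eta0.
exists d => // w0 w1 w [Lw0 solw alt] dw.
have TLw : (T%:E < LS w0 w1)%E.
  rewrite ltNge; apply/negP => LwT.
  case: alt => [Ly|[Tw LTw blowup]]; first by move: LwT; rewrite Ly leye_eq.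
  have Tw0 : 0 < Tw by move: Lw0; rewrite LTw lte_fin.
  have TwT : Tw <= T by move: LwT; rewrite LTw lee_fin.
  have : (+oo <= (2 * (1 + M))%:E :> \bar R)%E.
    rewrite -blowup; apply: limf_esup_left_le => // t /andP[t0 tTw].
    (* Any interval [0, S] with t <= S < Tw and 0 < S will do, also for t = 0. *)
    pose S := (t + Tw) / 2.
    have tS : t <= S by rewrite /S; lra.
    have STw : S < Tw by rewrite /S; lra.
    have S0 : 0 < S by rewrite /S; lra.
    have ST : S <= T by rewrite (le_trans (ltW STw)).
    have SI : `[0, S] `<=` [set t : R | 0 <= t /\ (t%:E < LS w0 w1)%E].
      by apply: life_interval_sub; rewrite LTw lte_fin.
    have tI : 0 <= t <= S by rewrite t0.
    have S0T : 0 < S <= T by rewrite S0.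
    have g := small _ _ _ _ _ solw S0T SI dw t tI.
    have g1 : gap ip e lam J u [set t : R | 0 <= t /\ (t%:E < LS w0 w1)%E] w t <= 1.
      by apply: le_trans g _; rewrite ge_min; apply/orP; right; lra.
    have tT : 0 <= t <= T by rewrite t0 (le_trans tS).
    have := perturbed_energy_le nrm onb lam0 solu TJ solw SI ST tI (enu t tT) g1.
    rewrite lee_fin; apply: le_trans; rewrite /state_energy.
    set a := _ ^+ 2; set b := _ ^+ 2.
    have := sqr_ge0 `|deriv_on [set t : R | 0 <= t /\ (t%:E < LS w0 w1)%E] w t|.
    have := sqr_ge0 `|powA ip e lam (1 / 2) (w t)|; lra.
  by rewrite leye_eq.
split=> // t tT.
have TT : 0 < T <= T by rewrite T0 lexx.
exact: (small _ _ _ _ T solw TT (life_interval_sub TLw) dw).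
Qed.

End maximal_perturbation.

Lemma ereal_le_lt_real {R : realType} (x y : \bar R) : (0 < x)%E ->
  (forall T : R, 0 < T -> (T%:E < x)%E -> (T%:E <= y)%E) -> (x <= y)%E.
Proof.
move=> x0 H; rewrite leNgt; apply/negP => yx.
have [T [T0 Tx yT]] : exists T : R, [/\ 0 < T, (T%:E < x)%E & (y < T%:E)%E].
  case: x x0 H yx => [r| |]//= r0 H yx.
    case: y H yx => [q| |]//= H yx.
      move: r0 yx; rewrite !lte_fin => r0 yx; exists (Num.max (r / 2) ((r + q) / 2)).
      split; rewrite ?lte_fin; first by rewrite lt_max divr_gt0.
        by rewrite gt_max; apply/andP; split; lra.
      by rewrite lt_max; apply/orP; right; lra.
    exists (r / 2); rewrite lte_fin ltNyr; move: r0; rewrite lte_fin => r0.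
    by split=> //; lra.
  case: y H yx => [q| |]//= H _.
    exists (Num.max 1 (q + 1)); rewrite ltry lte_fin !lt_max ltr01 ltrDl ltr01 orbT.
    by split.
  by exists 1; rewrite ltry ltNyr.
by have := H T T0 Tx; rewrite leNgt yT.
Qed.

Theorem theorem2p2 (R : realType) (H : completeNormedModType R)
  (ip : {dot H for idfun}) (DA : set H) (A : H -> H)
  (e : nat -> H) (lam : nat -> R) (m : R -> R) (nu0 : R)
  (u0e u1e : R -> H) (u0 u1 : H) (ue : R -> R -> H) (u : R -> H) :
  norm_from_dot ip ->
  self_adjoint ip DA A ->
  orthonormal_basis ip e ->
  (forall k, 0 <= lam k) ->
  (forall k, DA (e k) /\ A (e k) = lam k ^+ 2 *: e k) ->
  C1_on `[0, +oo[ m ->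
  0 < nu0 ->
  (forall sigma, 0 <= sigma -> nu0 <= m sigma) ->
  (forall eps, 0 < eps ->
     domP ip e lam (3 / 4) (u0e eps) /\ domP ip e lam (1 / 4) (u1e eps)) ->
  cvg_domP ip e lam (3 / 4) 0^'+ u0e u0 ->
  cvg_domP ip e lam (1 / 4) 0^'+ u1e u1 ->
  (forall eps, 0 < eps ->
     maximal_solution ip e lam m (u0e eps) (u1e eps) (ue eps)) ->
  maximal_solution ip e lam m u0 u1 u ->
  [/\ (limf_einf (fun eps => life_span ip e lam m (u0e eps) (u1e eps)) 0^'+
         >= life_span ip e lam m u0 u1)%E,
      (forall T, 0 < T -> (T%:E < life_span ip e lam m u0 u1)%E ->
         {uniform `[0, T],
           (fun eps => energy ip e lam `[0, T] (fun s => ue eps s - u s))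
             @ 0^'+ --> (fun=> 0)})
    & (domP ip e lam (5 / 4) u0 -> domP ip e lam (3 / 4) u1 ->
       forall T, 0 < T -> (T%:E < life_span ip e lam m u0 u1)%E ->
         exists Gamma : R, \forall eps \near 0^'+, forall t, 0 <= t <= T ->
           energy ip e lam `[0, T] (fun s => ue eps s - u s) t
             <= Gamma * energy ip e lam `[0, T] (fun s => ue eps s - u s) 0)].
Proof.
move=> nrm _ onb lam0 _ C1m nu0_gt0 m_ge data cvg0 cvg1 maxe maxu.
set LS := life_span ip e lam m.
set J := [set t : R | 0 <= t /\ (t%:E < LS u0 u1)%E].
have [L0 solu _] := maxu.
pose Je eps := [set t : R | 0 <= t /\ (t%:E < LS (u0e eps) (u1e eps))%E].
have data_near d : 0 < d -> \forall eps \near 0^'+,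
    0 < eps /\ state_energy ip e lam (u0e eps - u0) (u1e eps - u1) <= d.
  move=> d0.
  have [hu0 _ /cvgr0Pnorm_lt g0] := cvg0; have [_ _ /cvgr0Pnorm_lt g1] := cvg1.
  have r0 : 0 < Num.sqrt (d / 3) by rewrite sqrtr_gt0 divr_gt0.
  near=> eps.
  have eps0 : 0 < eps by near: eps; exact: nbhs_right_gt.
  split=> //; have [h0 h1] := data eps eps0.
  have hd : domP ip e lam (3 / 4) (u0e eps - u0) by exact: domPB.
  apply: le_trans (state_energy_le_graph nrm onb lam0 _ hd) _.
  have sq x : `|x| < Num.sqrt (d / 3) -> x ^+ 2 <= d / 3.
    move=> xr; rewrite -(@sqr_sqrtr _ (d / 3)) ?divr_ge0 ?(ltW d0)//.
    by rewrite -[x ^+ 2]real_normK ?num_real// ler_pXn2r ?nnegrE// ltW.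
  have a0 : graph_norm ip e lam (3 / 4) (u0e eps - u0) ^+ 2 <= d / 3.
    by apply: sq; near: eps; exact: g0.
  have a1 : graph_norm ip e lam (1 / 4) (u1e eps - u1) ^+ 2 <= d / 3.
    by apply: sq; near: eps; exact: g1.
  lra.
have close T eta : 0 < T -> (T%:E < LS u0 u1)%E -> 0 < eta ->
    \forall eps \near 0^'+, [/\ 0 < eps, (T%:E < LS (u0e eps) (u1e eps))%E
      & forall t, 0 <= t <= T ->
          gap ip e lam J u (Je eps) (ue eps) t <= Num.min eta (1 / 2)].
  move=> T0 TL eta0.
  have [d d0 small] := maximal_gap_small nrm onb lam0 C1m nu0_gt0 m_ge maxu T0 TL eta0.
  apply: filterS (data_near d d0) => eps [eps0 dle].
  by have [TLe gapT] := small _ _ _ (maxe eps eps0) dle.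
have energyE T eps t : 0 < T -> (T%:E < LS u0 u1)%E -> 0 < eps ->
    (T%:E < LS (u0e eps) (u1e eps))%E -> 0 <= t <= T ->
    energy ip e lam `[0, T] (fun s => ue eps s - u s) t =
    gap ip e lam J u (Je eps) (ue eps) t.
  move=> T0 TL eps0 TLe tT; have [_ sole _] := maxe eps eps0.
  apply: (energy_gap solu (life_interval_sub TL) sole) => //.
  exact: life_interval_sub.
split.
- apply: ereal_le_lt_real => // T T0 TL; rewrite limf_einfE.
  pose V := [set eps | 0 < eps /\ (T%:E < LS (u0e eps) (u1e eps))%E].
  apply: le_ereal_sup_tmp; exists (ereal_inf ((fun eps => LS (u0e eps) (u1e eps)) @` V)).
    exists V => //; apply: filterS (close T 1 T0 TL ltr01).
    by move=> eps [].
  by apply: le_ereal_inf_tmp => _ [eps [_ /ltW TLe] <-].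
- move=> T T0 TL P /uniform_nbhs[E [entE subP]].
  have /nbhs_ballP[d d0 dE] : nbhs (0 : R) (xsection E (0 : R)).
    exact: nbhs_entourage.
  have d20 : 0 < d / 2 by rewrite divr_gt0.
  apply: filterS (close T (d / 2) T0 TL d20) => eps [eps0 TLe gd].
  apply: subP => t /=; rewrite in_itv/= => tT.
  rewrite energyE//; apply/xsectionP; apply: dE.
  rewrite /ball/= sub0r normrN ger0_norm ?state_energy_ge0//.
  apply: le_lt_trans (gd t tT) _; rewrite gt_min; apply/orP; left; lra.
- move=> reg0 reg1 T T0 TL.
  have [G GP] := gap_lipschitz nrm onb lam0 C1m nu0_gt0 m_ge solu T0
    (life_interval_sub TL) reg0 reg1.
  exists G; apply: filterS (close T 1 T0 TL ltr01) => eps [eps0 TLe g1] t tT.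
  have [_ sole _] := maxe eps eps0.
  have z : (0 : R) <= 0 <= T by rewrite lexx ltW.
  rewrite !energyE//; apply: (GP _ _ _ _ sole (life_interval_sub TLe)) => // s sT.
  by apply: le_trans (g1 s sT) _; rewrite ge_min lexx.
Unshelve. all: by end_near. Qed.
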